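(* The following are equivalent: (a) There is a Banach space $X$ and a normalized weakly-null sequence $(x_n)_n$ in $X$ such that $\{x_n\}_n$ is a Banach-Saks set but its convex hull $\mathrm{conv}(\{x_n\}_n)$ is not a Banach-Saks set. (b) There is a family $\mathcal F$ of finite subsets of $\mathbb N$ such that the unit basis $(u_n)_n$ of the Schreier-like space $X_{\mathcal F}$ satisfies: $\{u_n\}_n$ is a Banach-Saks set but $\mathrm{conv}(\{u_n\}_n)$ is not. (c) There is a compact and hereditary family $\mathcal F$ of finite subsets of $\mathbb N$ such that: (c.1) $\mathcal F$ is not large in any infinite $M\subseteq\mathbb N$; (c.2) there are a partition $\mathbb N=\bigcup_n I_n$ into finite sets $I_n$, a probability measure $\mu_n$ on each $I_n$, and $\delta>0$ such that the family $$\mathcal G_\delta^{\bar\mu}(\mathcal F):=\{t\subseteq\mathbb N \text{ finite}: \text{there is } s\in\mathcal F \text{ with } \min_{n\in t}\mu_n(s\cap I_n)\ge\delta\}$$ is large in $\mathbb N$.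
   Context: A subset $A$ of a Banach space is a Banach-Saks set if every sequence in $A$ has a subsequence $(y_n)_n$ whose Ces\`aro means $\frac1n\sum_{k=1}^n y_k$ converge in norm. A family on a set $I$ is a collection of finite subsets of $I$; it is compact if it is compact in $2^I$ with the product topology, and hereditary if $s\subseteq t\in\mathcal F$ implies $s\in\mathcal F$. For $n\in\mathbb N$, a family $\mathcal F$ is $n$-large in $J$ if for every infinite $K\subseteq J$ there is $s\in\mathcal F$ with $\#(s\cap K)\ge n$; $\mathcal F$ is large in $J$ if it is $n$-large in $J$ for every $n$. For a family $\mathcal F$ on $\mathbb N$, the Schreier-like space $X_{\mathcal F}$ is the completion of $c_{00}(\mathbb N)$ under the norm $\|x\|_{\mathcal F}=\max\{\|x\|_\infty,\sup_{s\in\mathcal F}\sum_{n\in s}|(x)_n|\}$, where $(x)_n$ is the $n$-th coordinate; its unit basis $(u_n)_n$ is the sequence of unit vectors. *)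

(* Defs.v *)
From HB Require Import structures.
From mathcomp Require Import all_boot all_order all_algebra finmap.
From mathcomp Require Import all_classical all_reals all_analysis.
Import Order.TTheory GRing.Theory Num.Theory.
Import numFieldNormedType.Exports.

Set Implicit Arguments.
Unset Strict Implicit.
Unset Printing Implicit Defensive.

Local Open Scope classical_set_scope.
Local Open Scope ring_scope.


Definition cesaro {R : numDomainType} {V : lmodType R} (y : nat -> V) (n : nat) : V :=
  (n.+1%:R)^-1 *: \sum_(k < n.+1) y k.

Definition strictly_incr (phi : nat -> nat) : Prop := forall n, (phi n < phi n.+1)%N.

Definition conv_hull {R : numDomainType} {V : lmodType R} (A : set V) : set V :=
  [set z | exists (m : nat) (c : 'I_m -> R) (p : 'I_m -> V),
      (forall i, 0 <= c i) /\ \sum_(i < m) c i = 1 /\ (forall i, A (p i)) /\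
      z = \sum_(i < m) c i *: p i].

Definition BanachSaks_set {R : realType} {X : normedModType R} (A : set X) : Prop :=
  forall y : nat -> X, (forall n, A (y n)) ->
    exists phi, strictly_incr phi /\
      exists l : X, cesaro (y \o phi) @ \oo --> l.

Definition weakly_null {R : realType} {X : normedModType R} (x : nat -> X) : Prop :=
  forall f : {linear X -> R^o}, continuous f -> (f \o x) @ \oo --> (0 : R).

Definition fin_family := set {fset nat}.

Definition hereditary (F : fin_family) : Prop :=
  forall s t : {fset nat}, (s `<=` t)%fset -> F t -> F s.

Definition indic (s : {fset nat}) : {ptws nat -> bool} := fun n => n \in s.
Definition compact_family (F : fin_family) : Prop := compact (indic @` F).

Definition meets_at_least (s : {fset nat}) (K : set nat) (n : nat) : Prop :=
  (n <= #|` [fset i in s | `[< K i >]]%fset|)%N.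

Definition n_large (n : nat) (F : fin_family) (J : set nat) : Prop :=
  forall K : set nat, K `<=` J -> infinite_set K ->
    exists2 s, F s & meets_at_least s K n.

Definition large (F : fin_family) (J : set nat) : Prop := forall n, n_large n F J.

(* X_F is realised concretely as a space of real sequences: for x : nat -> R,
   normF F x = max(||x||_oo, sup_{s in F} sum_{n in s} |x_n|) in \bar R.
   The completion of (c00, ||.||_F) is the set of x : nat -> R which are
   ||.||_F-limits of finitely supported sequences (||.||_oo <= ||.||_F, so
   Cauchy sequences converge coordinatewise and the norm is lower
   semicontinuous), with norm normF. *)
Definition normF {R : realType} (F : fin_family) (x : nat -> R) : \bar R :=
  maxe (ereal_sup [set (`|x n|)%:E | n in [set: nat]])
       (ereal_sup [set (\sum_(n <- s) `|x n|)%:E | s in F]).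

Definition c00 {R : realType} : set (nat -> R) :=
  [set x | exists N, forall n, (N <= n)%N -> x n = 0].

Definition XF {R : realType} (F : fin_family) : set (nat -> R) :=
  [set x | exists y : nat -> (nat -> R), (forall k, c00 (y k)) /\
       (fun k => normF F (y k - x)) @ \oo --> 0%E].

Definition cvg_XF {R : realType} (F : fin_family) (z : nat -> (nat -> R)) : Prop :=
  exists2 x, XF F x & (fun k => normF F (z k - x)) @ \oo --> 0%E.

Definition BanachSaks_set_XF {R : realType} (F : fin_family) (A : set (nat -> R)) : Prop :=
  forall y : nat -> (nat -> R), (forall n, A (y n)) ->
    exists phi, strictly_incr phi /\ cvg_XF F (cesaro (y \o phi)).

Definition unit_vec {R : realType} (n : nat) : nat -> R := fun k => (k == n)%:R.

Definition partition_fin (I : nat -> {fset nat}) : Prop :=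
  (forall m, exists n, m \in I n) /\
  (forall n1 n2 m, m \in I n1 -> m \in I n2 -> n1 = n2).

Definition prob_on {R : realType} (I : {fset nat}) (w : nat -> R) : Prop :=
  (forall i, 0 <= w i) /\ (forall i, i \notin I -> w i = 0) /\
  \sum_(i <- I) w i = 1.

Definition meas {R : realType} (I : nat -> {fset nat}) (mu : nat -> nat -> R)
  (n : nat) (s : {fset nat}) : R := \sum_(i <- (s `&` I n)%fset) mu n i.

Definition G_family {R : realType} (F : fin_family) (I : nat -> {fset nat})
  (mu : nat -> nat -> R) (delta : R) : fin_family :=
  [set t | exists2 s, F s & forall n, n \in t -> delta <= meas I mu n s].

(* Main.v *)
(* (c) => (b): since F is not large, u_n has a subsequence along which every s in F
   meets few indices, so its Cesaro means are O(1/N). A hereditary large family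
   contains, by Ramsey's theorem and diagonalisation, all Schreier sets along some
   subsequence; applied to the family G this makes the averages of the mu_n-combinations
   of the u_i stay of norm at least delta.
   (b) => (a): the unit basis itself, weakly null because all Cesaro limits of its
   subsequences vanish.
   (a) => (c): a bad sequence in the convex hull can be taken, up to a convergent
   summand, as z_j = sum of w_j(n) x_n over consecutive intervals of n. If no
   subsequence of z is Cesaro-null, then for some e and some subsequence the sets
   {j : f(z_j) >= e}, f in the dual ball, form a large family. As f(z_j) >= e forces
   the w_j-mass of {n : f(x_n) >= e/2} to be at least e/2, one takes for F the
   sets on which some f satisfies f(x_n) >= e/2. The Banach-Saks property of (x_n)
   prevents F from being large, and hence makes F compact. *)
Require Import Defs.
From HB Require Import structures.
From mathcomp Require Import all_boot all_order all_algebra finmap.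
From mathcomp Require Import all_classical all_reals all_analysis.
From mathcomp Require Import lra.
Import Order.TTheory GRing.Theory Num.Theory.
Import numFieldNormedType.Exports.
Local Open Scope classical_set_scope.
Local Open Scope ring_scope.

Set Implicit Arguments.
Unset Strict Implicit.
Unset Printing Implicit Defensive.

(* Otherwise the name denotes the Cesaro theorem of MathComp-Analysis. *)
Local Notation cesaro := Defs.cesaro.

(** * Subsequences and Ramsey theory *)

Lemma strictly_incr_lt (phi : nat -> nat) : strictly_incr phi ->
  {mono phi : m n / (m < n)%N}.
Proof.
by move=> h; apply/leqW_mono/leq_mono; apply: homo_ltn => //; exact: ltn_trans.
Qed.

Lemma strictly_incr_inj (phi : nat -> nat) : strictly_incr phi -> injective phi.
Proof.
move=> phii m n e; have h := strictly_incr_lt phii.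
by case: (ltngtP m n) => //; rewrite -h e ltnn.
Qed.

Lemma strictly_incr_ge (phi : nat -> nat) n : strictly_incr phi -> (n <= phi n)%N.
Proof. by move=> h; elim: n => // n /leq_ltn_trans; apply; exact: h. Qed.

Lemma strictly_incr_comp (phi psi : nat -> nat) :
  strictly_incr phi -> strictly_incr psi -> strictly_incr (phi \o psi).
Proof. by move=> /strictly_incr_lt h hpsi n /=; rewrite h; apply: hpsi. Qed.

Lemma incr_of_unbounded (K : set nat) : (forall N, exists2 k, (N <= k)%N & K k) ->
  exists phi, strictly_incr phi /\ forall n, K (phi n).
Proof.
move=> h; have /choice[g hg] : forall N, exists k, (N <= k)%N /\ K k.
  by move=> N; have [k] := h N; exists k.
pose phi := fix phi n := if n is n'.+1 then g (phi n').+1 else g 0%N.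
exists phi; split => [n|[|n]]; [|exact: (hg _).2|exact: (hg _).2].
exact: (hg _).1.
Qed.

Lemma incr_of_infinite (K : set nat) : infinite_set K ->
  exists phi, strictly_incr phi /\ forall n, K (phi n).
Proof.
move=> Kinf; apply: incr_of_unbounded => N; apply: contrapT => h; apply: Kinf.
apply: (@sub_finite_set _ _ `I_N); last exact: finite_II.
move=> k Kk /=; rewrite ltnNge; apply/negP => Nk; apply: h.
by exists k.
Qed.

Lemma infinite_range_incr (phi : nat -> nat) :
  strictly_incr phi -> infinite_set (range phi).
Proof.
move=> h; rewrite (eq_finite_set (inj_card_eq _)); first exact: infinite_nat.
by move=> x y _ _; exact: strictly_incr_inj.
Qed.

Lemma prop_subseq (B : nat -> Prop) :
  exists phi, strictly_incr phi /\ ((forall n, B (phi n)) \/ (forall n, ~ B (phi n))).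
Proof.
have [h|h] := pselect (forall N, exists2 k, (N <= k)%N & B k).
  by have [phi [phii hphi]] := incr_of_unbounded h; exists phi; split; [|left].
have [N hN] : exists N, forall k, (N <= k)%N -> ~ B k.
  move/existsNP: h => [N hN]; exists N => k Nk Bk; apply: hN.
  by exists k.
exists (addn N); split; first by move=> n; rewrite addnS.
by right=> n; apply: hN; exact: leq_addr.
Qed.

(* Successive extraction of subsequences [chi n], with the diagonal sequence taken as
   the first terms [chi n 0]. *)
Lemma fusion (Q : nat -> (nat -> nat) -> (nat -> nat) -> Prop) (phi : nat -> nat) :
  strictly_incr phi ->
  (forall n chi, strictly_incr chi -> exists rho, strictly_incr rho /\
     Q n chi (fun i => chi (rho i).+1)) ->
  exists chi : nat -> nat -> nat, exists rho : nat -> nat -> nat,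
  [/\ chi 0 = phi, forall n, strictly_incr (chi n), forall n, strictly_incr (rho n),
   forall n, Q n (chi n) (chi n.+1) &
   forall n j, chi (n + j)%N 0%N = chi n (rho n j)].
Proof.
move=> phii hQ.
have /choice[g hg] : forall p : nat * (nat -> nat), exists rho, strictly_incr p.2 ->
    strictly_incr rho /\ Q p.1 p.2 (fun i => p.2 (rho i).+1).
  (* [choice] needs a witness at every pair; [id] is the default when [chi] is not increasing. *)
  move=> [n chi]; have [h|h] := pselect (strictly_incr chi); last by exists id.
  by have [rho hrho] := hQ n _ h; exists rho.
pose chi := fix chi n := if n is n'.+1 then
  (fun i => chi n' (g (n', chi n') i).+1) else phi.
have chii n : strictly_incr (chi n).
  elim: n => [//|n IH] /=; have [h _] := hg (n, chi n) IH.
  by move=> i; rewrite strictly_incr_lt// ltnS; exact: h.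
(* [chi n.+1] is [chi n] composed with [sig n]. The successor drops the first term of each stage,
   which makes the diagonal strictly increasing. *)
pose sig n i := (g (n, chi n) i).+1.
have sigi n : strictly_incr (sig n).
  by have [h _] := hg (n, chi n) (chii n) => i; rewrite /sig ltnS; exact: h.
pose comp n := fix comp j := if j is j'.+1 then comp j' \o sig (n + j')%N else id.
have compi n j : strictly_incr (comp n j).
  by elim: j => [//|j IH]; exact: strictly_incr_comp.
have compE n j i : chi (n + j)%N i = chi n (comp n j i).
  by elim: j i => [|j IH] i; [rewrite addn0|rewrite addnS /= IH].
exists chi, (fun n j => comp n j 0%N); split=> //.
- by move=> n j /=; rewrite strictly_incr_lt.
- by move=> n; exact: (hg (n, chi n) (chii n)).2.
Qed.

Lemma fusion_incr (chi rho : nat -> nat -> nat) :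
  (forall n, strictly_incr (chi n)) -> (forall n, strictly_incr (rho n)) ->
  (forall n j, chi (n + j)%N 0%N = chi n (rho n j)) ->
  strictly_incr (fun n => chi n 0%N).
Proof.
move=> chii rhoi h n; have := h n 0%N; have := h n 1%N; rewrite addn0 addn1 => -> ->.
by rewrite strictly_incr_lt//; apply: rhoi.
Qed.

(** Increasing lists of length [n] stand for [n]-element sets. In the induction, the case [n] is
    applied to the tails above a fixed least element; on the diagonal sequence the colour of a set
    then depends on its least element only, and [prop_subseq] makes it constant. *)
Lemma infinite_ramsey (n : nat) (P : seq nat -> Prop) :
  exists phi, strictly_incr phi /\
    ((forall u, sorted ltn u -> size u = n -> P (map phi u)) \/
     (forall u, sorted ltn u -> size u = n -> ~ P (map phi u))).
Proof.
elim: n P => [|n IH] P.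
  exists id; split => //.
  by have [h|h] := pselect (P [::]); [left|right] => u _ /size0nil ->.
pose Q (k : nat) (chi chi' : nat -> nat) :=
  (forall u, sorted ltn u -> size u = n -> P (chi 0%N :: map chi' u)) \/
  (forall u, sorted ltn u -> size u = n -> ~ P (chi 0%N :: map chi' u)).
have [|k chi chii|chi [rho [_ chii rhoi chiQ chiE]]] := @fusion Q id; first exact: ltnSn.
  have [rho [rhoi h]] := IH (fun u => P (chi 0%N :: map (fun i => chi i.+1) u)).
  exists rho; split => //; rewrite /Q.
  by case: h => h; [left|right] => u su zu; have := h u su zu; rewrite -map_comp.
have di := fusion_incr chii rhoi chiE.
have [phi [phii hphi]] := prop_subseq
  (fun k => forall u, sorted ltn u -> size u = n -> P (chi k 0%N :: map (chi k.+1) u)).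
have key (B : seq nat -> Prop) :
    (forall k u, sorted ltn u -> size u = n ->
        B (chi (phi k) 0%N :: map (chi (phi k).+1) u)) ->
    forall u, sorted ltn u -> size u = n.+1 ->
        B (map ((fun k => chi k 0%N) \o phi) u).
  move=> hB [//|k u] /= su [zu].
  (* By [chiE], the entries after the first are terms of the stage [chi (phi k).+1], at the indices
     [v]. *)
  pose v := map (fun j => rho (phi k).+1 (phi j - (phi k).+1)%N) u.
  have ku j : j \in u -> (phi k < phi j)%N.
    move=> ju; rewrite strictly_incr_lt//.
    by move: su; rewrite (path_sortedE ltn_trans) => /andP[/allP + _]; apply.
  have -> : map ((fun k => chi k 0%N) \o phi) u = map (chi (phi k).+1) v.
    rewrite /v -map_comp; apply/eq_in_map => j ju /=; rewrite -chiE subnKC//.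
    exact: ku.
  apply: hB; last by rewrite size_map.
  have := path_sorted su; rewrite /v => su'.
  apply: (homo_sorted_in _ (allss u) su') => i j iu ju ij.
  move: ij; rewrite /= => ij; rewrite strictly_incr_lt// ltn_sub2r//; last first.
    by rewrite strictly_incr_lt.
  by apply: leq_ltn_trans (ku _ iu) _; rewrite strictly_incr_lt.
exists ((fun k => chi k 0%N) \o phi); split; first exact: strictly_incr_comp.
case: hphi => hphi; [left|right].
  by apply: key => k u su zu; exact: hphi.
apply: (key (fun u => ~ P u)) => k u su zu.
by case: (chiQ (phi k)) => // h; [have := hphi k; tauto|exact: h].
Qed.

(** Turns a cardinality into an increasing list of indices, the form in which [infinite_ramsey]
    speaks of sets. *)
Lemma meets_at_least_seq (s : {fset nat}) (kappa : nat -> nat) n :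
  strictly_incr kappa -> meets_at_least s (range kappa) n ->
  exists u, [/\ sorted ltn u, size u = n & forall i, i \in u -> kappa i \in s].
Proof.
move=> ki; rewrite /meets_at_least.
set t := [fset i in s | _]%fset => nt.
(* If [kappa i] is in [s], then [i <= kappa i] puts [i] below [B]. *)
pose B := (\max_(i <- s) i).+1.
pose L := [seq i <- iota 0 B | kappa i \in s].
have tL : (t `<=` [fset x in map kappa L])%fset.
  apply/fsubsetP => x; rewrite !inE => /andP[xs /asboolP[i _ xE]].
  apply/mapP; exists i => //; rewrite mem_filter mem_iota xE xs /= add0n ltnS.
  rewrite (leq_trans (strictly_incr_ge i ki))// xE.
  by rewrite (bigD1_seq x) ?fset_uniq //= leq_maxl.
have nL : (n <= size L)%N.
  rewrite (leq_trans nt)// (leq_trans (fsubset_leq_card tL))//.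
  by rewrite card_fseq (leq_trans (size_undup _))// size_map.
exists (take n L); split; last by move=> i /mem_take; rewrite mem_filter => /andP[].
  by apply: take_sorted; apply: sorted_filter; [exact: ltn_trans|exact: iota_ltn_sorted].
by rewrite size_takel.
Qed.

(** At stage [n], Ramsey's theorem for [n+1]-element sets decides membership in [F], and largeness
    with heredity excludes the negative answer. A Schreier set of size [n+1] has all its elements at
    least [n+1], so on the diagonal it lies within the stage that settles its size. *)
Lemma large_schreier (F : fin_family) (phi : nat -> nat) :
  hereditary F -> strictly_incr phi -> large F (range phi) ->
  exists psi, strictly_incr psi /\
    forall u, sorted ltn u -> (forall i, i \in u -> (size u <= i)%N) ->
      F [fset x in map (phi \o psi) u]%fset.
Proof.
move=> hF phii lF.
pose Q (n : nat) (chi chi' : nat -> nat) := forall u, sorted ltn u -> size u = n.+1 ->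
  F [fset x in map (phi \o chi') u]%fset.
have [|n chi chii|chi [rho [_ chii rhoi chiQ chiE]]] := @fusion Q id; first exact: ltnSn.
  have [rho [rhoi [h|h]]] := infinite_ramsey n.+1
    (fun u => F [fset x in map (fun i => phi (chi i.+1)) u]%fset).
    by exists rho; split => // u su zu; have := h u su zu; rewrite -map_comp.
  pose kappa := phi \o (fun i => chi (rho i).+1).
  have ki : strictly_incr kappa.
    by apply: strictly_incr_comp => // i; rewrite strictly_incr_lt// ltnS; exact: rhoi.
  have [|s Fs /(meets_at_least_seq ki)[u [su zu us]]] :=
    lF n.+1 (range kappa) _ (infinite_range_incr ki).
    by move=> _ [i _ <-]; exists (chi (rho i).+1).
  case: (h u su zu); apply: hF Fs; apply/fsubsetP => x; rewrite inE -map_comp.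
  by move=> /mapP[i iu ->]; exact: us.
exists (fun n => chi n 0%N); split; first exact: fusion_incr chiE.
move=> u su hu.
(* The stages treat sizes [n.+1] only; the empty set belongs to [F] because 0-largeness makes [F]
   nonempty. *)
have [->|[n nu]] : u = [::] \/ exists n, size u = n.+1.
  by case: u {su hu} => [|x u]; [left|right; exists (size u)].
- have [s Fs _] := lF 0%N (range phi) (@subset_refl _ _) (infinite_range_incr phii).
  by apply: hF Fs; apply/fsubsetP => x; rewrite inE.
pose v := map (fun j => rho (size u) (j - size u)%N) u.
have -> : map (phi \o (fun n => chi n 0%N)) u = map (phi \o chi (size u)) v.
  rewrite /v -map_comp; apply/eq_in_map => j ju /=; rewrite -chiE subnKC//.
  exact: hu.
have := chiQ n v; rewrite -nu; apply; last by rewrite size_map.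
apply: (homo_sorted_in _ (allss u) su) => i j iu ju ij.
move: ij; rewrite /= => ij; rewrite strictly_incr_lt// ltn_sub2r//.
exact: leq_ltn_trans (hu _ iu) ij.
Qed.

(** Ramsey's theorem for pairs: if no pair increases, the values are constant from a point where
    they are minimal. *)
Lemma nat_subseq (m : nat -> nat) : exists phi, strictly_incr phi /\
  (strictly_incr (m \o phi) \/ exists v, forall i, m (phi i) = v).
Proof.
have [phi [phii [h|h]]] := infinite_ramsey 2
  (fun u => (m (nth 0%N u 0) < m (nth 0%N u 1))%N).
  by exists phi; split => //; left => n; apply: (h [:: n; n.+1]) => //=; rewrite ltnSn.
have [i0 hi0] : exists i0, forall j, (m (phi i0) <= m (phi j))%N.
  have [|j] := @ex_minnP (fun v => `[< exists i, m (phi i) = v >]).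
    by exists (m (phi 0%N)); apply/asboolP; exists 0%N.
  move=> /asboolP[i0 <-] hi0; exists i0 => k; apply: hi0; apply/asboolP.
  by exists k.
exists (phi \o addn i0); split.
  by apply: strictly_incr_comp => // n; rewrite addnS.
right; exists (m (phi i0)) => -[|i] /=; first by rewrite addn0.
apply/eqP; rewrite eqn_leq hi0 andbT leqNgt; apply/negP.
by apply: (h [:: i0; i0 + i.+1]%N) => //=; rewrite addnS ltnS leq_addr.
Qed.

(** * Norming functionals *)

Definition sublinear {R : realType} {V : lmodType R} (q : V -> R) : Prop :=
  (forall x y, q (x + y) <= q x + q y) /\ (forall t x, 0 <= t -> q (t *: x) = t * q x).

(** The reverse inequality in homogeneity comes from applying the given one to [t^-1]. *)
Lemma sublinear_suff {R : realType} {V : lmodType R} (q : V -> R) :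
  (forall x y, q (x + y) <= q x + q y) ->
  (forall t x, 0 < t -> q (t *: x) <= t * q x) -> q 0 = 0 -> sublinear q.
Proof.
move=> qD qZ q0; split=> // t x; rewrite le_eqVlt => /predU1P[<-|t0].
  by rewrite scale0r mul0r.
apply/eqP; rewrite eq_le qZ//= -ler_pdivlMl//.
by rewrite -{1}[x]scale1r -(mulVf (lt0r_neq0 t0)) -scalerA qZ// invr_gt0.
Qed.

Lemma sublinear0 {R : realType} {V : lmodType R} (q : V -> R) : sublinear q -> q 0 = 0.
Proof. by move=> [_ qZ]; rewrite -(scale0r 0) qZ// mul0r. Qed.

Lemma sublinear_lbound {R : realType} {V : lmodType R} (q : V -> R) x :
  sublinear q -> - q (- x) <= q x.
Proof.
move=> qs; have := qs.1 x (- x); rewrite subrr sublinear0//; lra.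
Qed.

(** The auxiliary functional in the proof of Hahn-Banach by minimal sublinear functionals: a
    sublinear minorant of [q], as [t = 0] shows, with value at most [- q y] at [- y], as [t = 1]
    shows. *)
Definition slope_inf {R : realType} {V : lmodType R} (q : V -> R) (y x : V) : R :=
  inf [set q (x + t *: y) - t * q y | t in [set t | 0 <= t]].

Lemma slope_inf_le {R : realType} {V : lmodType R} (q : V -> R) y x t :
  sublinear q -> 0 <= t -> slope_inf q y x <= q (x + t *: y) - t * q y.
Proof.
move=> qs t0; apply: ge_inf; last by exists t.
(* The set is bounded below because [s *: y] is the sum of [x + s *: y] and [- x]. *)
exists (- q (- x)) => _ [s /= s0 <-].
have := qs.1 (x + s *: y) (- x); rewrite addrC addKr qs.2//; lra.
Qed.

Lemma slope_inf_ge {R : realType} {V : lmodType R} (q : V -> R) y x r :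
  (forall t, 0 <= t -> r <= q (x + t *: y) - t * q y) -> r <= slope_inf q y x.
Proof.
move=> h; apply: lb_le_inf; first by exists (q (x + 0 *: y) - 0 * q y), 0 => /=.
by move=> _ [t /= t0 <-]; exact: h.
Qed.

Lemma sublinear_slope_inf {R : realType} {V : lmodType R} (q : V -> R) y :
  sublinear q -> sublinear (slope_inf q y).
Proof.
move=> qs; apply: sublinear_suff => [x1 x2|t x t0|].
- rewrite -lerBlDr; apply: slope_inf_ge => t t0.
  rewrite lerBlDr -lerBlDl; apply: slope_inf_ge => s s0.
  (* The parameters used for the two summands add up to one for their sum. *)
  have := @slope_inf_le _ _ q y (x1 + x2) (s + t) qs (addr_ge0 s0 t0).
  have := qs.1 (x1 + t *: y) (x2 + s *: y).
  rewrite scalerDl addrACA (addrC (s *: y)); lra.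
- rewrite -ler_pdivrMl//; apply: slope_inf_ge => s s0.
  rewrite ler_pdivrMl//.
  have := @slope_inf_le _ _ q y (t *: x) (t * s) qs (mulr_ge0 (ltW t0) s0).
  by rewrite -scalerA -scalerDr qs.2 ?(ltW t0)// mulrBr mulrA.
- apply/eqP; rewrite eq_le; apply/andP; split.
    have := @slope_inf_le _ _ q y 0 0 qs (lexx 0).
    by rewrite scale0r addr0 (sublinear0 qs) mul0r subr0.
  by apply: slope_inf_ge => t t0; rewrite add0r qs.2// subrr.
Qed.

(** Zorn's lemma for the reversed pointwise order, whose maximal elements are the minimal
    functionals. A nonempty chain is bounded by its pointwise infimum, the empty one by [p]. *)
Lemma exists_minimal_sublinear {R : realType} {V : lmodType R} (p : V -> R) :
  sublinear p -> exists q, [/\ sublinear q, (forall x, q x <= p x) &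
    forall q', sublinear q' -> (forall x, q' x <= q x) -> q' = q].
Proof.
move=> ps; pose T := {q : V -> R | sublinear q /\ forall x, q x <= p x}.
pose le (q1 q2 : T) := `[< forall x, sval q2 x <= sval q1 x >].
have [| | | |[q [qs qp]] qmin] := @Zorn T le.
- by move=> t; apply/asboolP.
- move=> r s t /asboolP rs /asboolP st; apply/asboolP => x.
  exact: le_trans (st x) (rs x).
- move=> [s s'] [t t'] /asboolP /= st /asboolP /= ts; apply: eq_exist.
  by apply/funext => x; apply/eqP; rewrite eq_le st ts.
- move=> A Atot; have [[a Aa]|/nonemptyPn A0] := pselect (A !=set0); last first.
    by exists (exist _ p (conj ps (fun x => lexx _))) => s; rewrite A0.
  pose q x := inf [set sval s x | s in A].
  have qle s x : A s -> q x <= sval s x.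
    move=> As; apply: ge_inf; last by exists s.
    exists (- p (- x)) => _ [[s' [s's s'p]] /= _ <-].
    by apply: le_trans (sublinear_lbound x s's); rewrite lerN2.
  have qge r x : (forall s, A s -> r <= sval s x) -> r <= q x.
    move=> h; apply: lb_le_inf; first by exists (sval a x), a.
    by move=> _ [s As <-]; exact: h.
  have qs : sublinear q.
    apply: sublinear_suff => [x y|t x t0|].
    + rewrite -lerBlDr; apply: (qge _ _) => s As.
      rewrite lerBlDr -lerBlDl; apply: (qge _ _) => s' As'.
      (* Subadditivity requires one functional for both arguments: the smaller of the two chain
         members. *)
      rewrite lerBlDr; case: (Atot s s' As As') => /asboolP ss.
      * apply: le_trans (qle s' _ As') _.
        by apply: le_trans ((svalP s').1.1 _ _) _; rewrite addrC lerD2l.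
      * apply: le_trans (qle s _ As) _.
        by apply: le_trans ((svalP s).1.1 _ _) _; rewrite addrC lerD2r.
    + rewrite -ler_pdivrMl//; apply: (qge _ _) => s As; rewrite ler_pdivrMl//.
      by rewrite -(svalP s).1.2 ?(ltW t0)//; exact: qle.
    + apply/eqP; rewrite eq_le; apply/andP; split.
        by rewrite -(sublinear0 (svalP a).1); exact: qle.
      by apply: (qge _ _) => s As; rewrite (sublinear0 (svalP s).1).
  have qp x : q x <= p x by apply: le_trans (qle a x Aa) ((svalP a).2 x).
  by exists (exist _ q (conj qs qp)) => s As; apply/asboolP => x; exact: qle.
exists q; split => // q' q's q'q.
have q'p x : q' x <= p x by exact: le_trans (q'q x) (qp x).
have := qmin (exist _ q' (conj q's q'p)); rewrite /le /= => /(_ _)/(congr1 sval)/=.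
by apply; apply/asboolP.
Qed.

(* A minimal sublinear [q] equals [slope_inf q y], whose value at [- y] is at most
   [- q y]. *)
Lemma minimal_sublinear_linear {R : realType} {V : lmodType R} (q : V -> R) :
  sublinear q -> (forall q', sublinear q' -> (forall x, q' x <= q x) -> q' = q) ->
  linear (q : V -> R^o).
Proof.
move=> qs qmin; have qN y : q (- y) = - q y.
  have := @slope_inf_le _ _ q y (- y) 1 qs ler01.
  rewrite (qmin (slope_inf q y)) ?scale1r ?addNr ?(sublinear0 qs); first 1 last.
  - exact: sublinear_slope_inf.
  - by move=> x; have := @slope_inf_le _ _ q y x 0 qs (lexx _);
       rewrite scale0r addr0 mul0r subr0.
  have := sublinear_lbound (- y) qs; rewrite opprK; lra.
have qD x y : q (x + y) = q x + q y.
  apply/eqP; rewrite eq_le qs.1 /=.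
  by have := qs.1 (- x) (- y); rewrite -opprD !qN; lra.
move=> t x y; rewrite qD; congr (_ + _).
have [t0|t0] := leP 0 t; first by rewrite qs.2.
have := qs.2 (- t) x; rewrite oppr_ge0 (ltW t0) scaleNr qN mulNr => /(_ isT).
exact: oppr_inj.
Qed.

(** Hahn-Banach for one vector. The minimal functional is taken below [slope_inf v] of the norm
    instead of the norm itself; this forces its value at [- v] to be at most minus the norm of
    [v]. *)
Lemma norming_functional {R : realType} {V : normedModType R} (v : V) :
  exists f : {linear V -> R^o}, (forall x, f x <= `|x|) /\ f v = `|v|.
Proof.
pose p := @Num.norm R V.
have ps : sublinear p.
  by split; [exact: ler_normD | move=> t x t0; rewrite /p normrZ ger0_norm].
have [q [qs qp qmin]] := exists_minimal_sublinear (sublinear_slope_inf v ps).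
have qlin := minimal_sublinear_linear qs qmin.
pose f : {linear V -> R^o} := HB.pack (q : V -> R^o)
  (GRing.isLinear.Build R V R^o *:%R q qlin).
have fp x : f x <= `|x|.
  apply: le_trans (qp x) _; have := @slope_inf_le _ _ p v x 0 ps (lexx _).
  by rewrite scale0r addr0 mul0r subr0.
exists f; split => //; apply/eqP; rewrite eq_le fp /=.
rewrite -lerN2 -[leLHS](linearN f); apply: le_trans (qp _) _.
have := @slope_inf_le _ _ p v (- v) 1 ps ler01.
by rewrite scale1r addNr (sublinear0 ps) mul1r sub0r.
Qed.

(** * The space of sequences of finite norm *)

Lemma normF_le {R : realType} (F : fin_family) (x : nat -> R) (M : R) :
  (normF F x <= M%:E)%E <->
  (forall n, `|x n| <= M) /\ (forall s, F s -> \sum_(n <- s) `|x n| <= M).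
Proof.
rewrite /normF ge_max; split=> [/andP[h1 h2]|[h1 h2]].
  split=> [n|s Fs]; rewrite -lee_fin.
    by apply: le_trans h1; apply: ereal_sup_ubound; exists n.
  by apply: le_trans h2; apply: ereal_sup_ubound; exists s.
apply/andP; split; apply: ge_ereal_sup => _ [n h <-]; rewrite lee_fin//.
exact: h2.
Qed.

Lemma normF_ge0 {R : realType} (F : fin_family) (x : nat -> R) : (0 <= normF F x)%E.
Proof.
rewrite /normF le_max; apply/orP; left.
by apply: (@le_trans _ _ `|x 0%N|%:E); [rewrite lee_fin|apply: ereal_sup_ubound; exists 0%N].
Qed.

Definition finite_normF {R : realType} (F : fin_family) : {pred (nat -> R)} :=
  fun x => `[< exists M : R, (normF F x <= M%:E)%E >].

Lemma finite_normF_fin {R : realType} (F : fin_family) (x : nat -> R) :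
  x \in finite_normF F -> normF F x = (fine (normF F x))%:E.
Proof.
rewrite unfold_in => /asboolP[M xM]; rewrite fineK// ge0_fin_numE ?normF_ge0//.
exact: le_lt_trans xM (ltry _).
Qed.

Lemma finite_normF_submod {R : realType} (F : fin_family) : submod_closed (@finite_normF R F).
Proof.
split.
  apply/asboolP; exists 0; apply/normF_le; split => [n|s _]; first by rewrite normr0.
  by rewrite big1// => i _; rewrite normr0.
move=> a x y /asboolP[M /normF_le[M1 M2]] /asboolP[N /normF_le[N1 N2]].
apply/asboolP; exists (`|a| * M + N); apply/normF_le.
have h n : `|(a *: x + y) n| <= `|a| * `|x n| + `|y n|.
  by apply: le_trans (ler_normD _ _) _; rewrite normrM.
split => [n|s Fs]; first by apply: le_trans (h n) _; rewrite lerD// ler_wpM2l.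
apply: le_trans (ler_sum _ (fun n _ => h n)) _.
by rewrite big_split -mulr_sumr /= lerD ?ler_wpM2l ?M2 ?N2.
Qed.

HB.instance Definition _ (R : realType) (F : fin_family) :=
  GRing.isSubmodClosed.Build R (nat -> R) (@finite_normF R F) (@finite_normF_submod R F).

(* The space X_F of the paper is the closure of c00 in this Banach space. *)
Record normF_space (R : realType) (F : fin_family) :=
  NormFSpace { nfval : nat -> R; _ : nfval \in finite_normF F }.

HB.instance Definition _ (R : realType) (F : fin_family) := [isSub for @nfval R F].
HB.instance Definition _ (R : realType) (F : fin_family) :=
  [Choice of normF_space R F by <:].
HB.instance Definition _ (R : realType) (F : fin_family) :=
  [SubChoice_isSubLmodule of normF_space R F by <:].

Definition nfnorm {R : realType} {F : fin_family} (x : normF_space R F) : R :=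
  fine (normF F (nfval x)).

Lemma nfnorm_le {R : realType} {F : fin_family} (x : normF_space R F) M :
  nfnorm x <= M <->
  (forall n, `|nfval x n| <= M) /\ (forall s, F s -> \sum_(n <- s) `|nfval x n| <= M).
Proof. by rewrite -normF_le (finite_normF_fin (valP x)) lee_fin. Qed.

Lemma nfnorm_coord {R : realType} {F : fin_family} (x : normF_space R F) n :
  `|nfval x n| <= nfnorm x.
Proof. by have /nfnorm_le[h _] := lexx (nfnorm x). Qed.

Lemma nfnorm_sum {R : realType} {F : fin_family} (x : normF_space R F) s :
  F s -> \sum_(n <- s) `|nfval x n| <= nfnorm x.
Proof. by have /nfnorm_le[_ h] := lexx (nfnorm x); exact: h. Qed.

Lemma nfnormD {R : realType} {F : fin_family} (x y : normF_space R F) :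
  nfnorm (x + y) <= nfnorm x + nfnorm y.
Proof.
apply/nfnorm_le; split=> [n|s Fs].
  by apply: le_trans (ler_normD _ _) _; rewrite lerD// nfnorm_coord.
apply: le_trans (ler_sum _ (fun n _ => ler_normD (nfval x n) (nfval y n))) _.
by rewrite big_split /= lerD// nfnorm_sum.
Qed.

Lemma nfnormZ_le {R : realType} {F : fin_family} (a : R) (x : normF_space R F) :
  nfnorm (a *: x) <= `|a| * nfnorm x.
Proof.
have h n : `|nfval (a *: x) n| = `|a| * `|nfval x n| by rewrite -normrM.
apply/nfnorm_le; split=> [n|s Fs]; first by rewrite h ler_wpM2l// nfnorm_coord.
by under eq_bigr do rewrite h; rewrite -mulr_sumr ler_wpM2l// nfnorm_sum.
Qed.

Lemma nfnormZ {R : realType} {F : fin_family} (a : R) (x : normF_space R F) :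
  nfnorm (a *: x) = `|a| * nfnorm x.
Proof.
apply/eqP; rewrite eq_le nfnormZ_le /=.
have [->|a0] := eqVneq a 0.
  by rewrite normr0 mul0r fine_ge0// normF_ge0.
rewrite -ler_pdivlMl ?normr_gt0//.
by rewrite -normfV -{1}(scale1r x) -(mulVf a0) -scalerA nfnormZ_le.
Qed.

Lemma nfnorm_eq0 {R : realType} {F : fin_family} (x : normF_space R F) :
  nfnorm x = 0 -> x = 0.
Proof.
move=> x0; apply: val_inj; apply/funext => n /=.
by apply/eqP; rewrite -normr_le0 -x0 nfnorm_coord.
Qed.

HB.instance Definition _ (R : realType) (F : fin_family) :=
  Lmodule_isNormed.Build R (normF_space R F) (@nfnormD R F) (@nfnormZ R F) (@nfnorm_eq0 R F).

Lemma nfnormE {R : realType} {F : fin_family} (x : normF_space R F) : `|x| = nfnorm x.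
Proof. by []. Qed.

(** Coordinates of a Cauchy filter converge. Each inequality that defines the norm involves finitely
    many coordinates, so it passes to the limit; the limit has finite norm as the difference of [x]
    and [x - l]. *)
Lemma normF_space_complete (R : realType) (F : fin_family) (G : set_system (normF_space R F)) :
  ProperFilter G -> cauchy G -> cvg G.
Proof.
move=> GG /cauchy_ballP Gc.
have coordc n : cvg ((fun x : normF_space R F => nfval x n) @ G).
  apply: cauchy_cvg; apply/cauchy_ballP => e e0.
  have := Gc e e0; rewrite !near_simpl => -[[P Q] /= [GP GQ] PQ].
  exists ((fun x : normF_space R F => nfval x n) @` P,
          (fun x : normF_space R F => nfval x n) @` Q) => /=.
    by split; [apply: filterS GP|apply: filterS GQ] => x Px; exists x.
  move=> [_ _] /= [[x Px <-] [y Qy <-]].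
  have := PQ (x, y) (conj Px Qy); rewrite /ball /= /ball_ => h.
  exact: le_lt_trans (nfnorm_coord (x - y) n) h.
pose l n : R := lim ((fun x : normF_space R F => nfval x n) @ G).
have near_l e : 0 < e -> \forall x \near G,
    (forall n, `|nfval x n - l n| <= e) /\
    (forall s, F s -> \sum_(n <- s) `|nfval x n - l n| <= e).
  move=> e0; have := Gc e e0; rewrite near_simpl => -[[P Q] /= [GP GQ] PQ].
  apply: filterS GP => x Px.
  have cl n : `|nfval x n - nfval y n| @[y --> G] --> `|nfval x n - l n|.
    by apply: cvg_norm; apply: cvgB; [exact: cvg_cst|exact: coordc].
  have xy y : Q y -> nfnorm (x - y) <= e.
    by move=> Qy; apply: ltW; have := PQ (x, y) (conj Px Qy).
  split => [n|s Fs].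
    apply: (cvgr_to_le (cl n)); apply: filterS GQ => y /xy.
    by apply: le_trans; exact: (nfnorm_coord (x - y)).
  have cs : \sum_(n <- s) `|nfval x n - nfval y n| @[y --> G] -->
      \sum_(n <- s) `|nfval x n - l n|.
    by apply: cvg_big => //; exact: add_continuous.
  apply: (cvgr_to_le cs); apply: filterS GQ => y /xy.
  by apply: le_trans; exact: (nfnorm_sum (x - y) Fs).
have lF : l \in finite_normF F.
  have /filter_ex[x [h1 h2]] := near_l 1 ltr01.
  have dF : nfval x - l \in finite_normF F by apply/asboolP; exists 1; exact/normF_le.
  by have := rpredB (valP x) dF; rewrite subKr.
apply/cvg_ex; exists (NormFSpace lF); apply/cvgrPdist_le => e e0.
apply: filterS (near_l e e0) => x [h1 h2].
by rewrite distrC nfnormE; apply/nfnorm_le.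
Qed.

HB.instance Definition _ (R : realType) (F : fin_family) :=
  Uniform_isComplete.Build (normF_space R F) (@normF_space_complete R F).

Lemma ler_sum_uniq {R : numDomainType} {I : eqType} (s s' : seq I) (f : I -> R) :
  (forall i, 0 <= f i) -> uniq s -> (forall i, i \in s -> f i != 0 -> i \in s') ->
  \sum_(i <- s) f i <= \sum_(i <- s') f i.
Proof.
move=> f0; elim: s s' => [|a s IH] s' /=; first by rewrite big_nil sumr_ge0.
move=> /andP[as1 us] ss'; rewrite big_cons.
have [fa|fa] := eqVneq (f a) 0.
  by rewrite fa add0r; apply: IH => // i si; apply: ss'; rewrite inE si orbT.
rewrite [leRHS](big_rem a) ?ss' ?mem_head//= lerD2l; apply: IH => // i si fi.
apply: rem_mem; last by rewrite ss'// inE si orbT.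
by apply: contraNneq as1 => <-.
Qed.

(** * Finitely supported sequences and the passage to [X_F] *)

Lemma c00_finite_normF {R : realType} (F : fin_family) (x : nat -> R) :
  c00 x -> x \in finite_normF F.
Proof.
move=> [N xN]; apply/asboolP; exists (\sum_(n <- iota 0 N) `|x n|).
have xI i : `|x i| != 0 -> i \in iota 0 N.
  by rewrite mem_iota add0n ltnNge normr_eq0; apply: contraNN => /xN ->.
apply/normF_le; split => [n|s _]; last by apply: ler_sum_uniq => // i _; exact: xI.
have := @ler_sum_uniq R nat [:: n] (iota 0 N) (fun n => `|x n|).
by rewrite big_seq1; apply => // i _; exact: xI.
Qed.

Lemma nfval_sum {R : realType} (F : fin_family) (I : Type) (r : seq I) (P : pred I)
    (y : I -> normF_space R F) :
  nfval (\sum_(i <- r | P i) y i) = \sum_(i <- r | P i) nfval (y i).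
Proof. by elim/big_rec2: _ => // i u v _ <-. Qed.

Lemma nfval_sum_coord {R : realType} (F : fin_family) (I : Type) (r : seq I) (P : pred I)
    (y : I -> normF_space R F) n :
  nfval (\sum_(i <- r | P i) y i) n = \sum_(i <- r | P i) nfval (y i) n.
Proof. by elim/big_rec2: _ => // i u v _ <-. Qed.

Lemma nfval_cesaro {R : realType} (F : fin_family) (y : nat -> normF_space R F) n :
  nfval (cesaro y n) = cesaro (fun k => nfval (y k)) n.
Proof. by rewrite /cesaro -nfval_sum. Qed.

Lemma normF_cvg0 {R : realType} (F : fin_family) (w : nat -> normF_space R F) :
  (fun k => normF F (nfval (w k))) @ \oo --> 0%E <-> w @ \oo --> (0 : normF_space R F).
Proof.
under eq_fun do rewrite finite_normF_fin ?(valP (w _))//.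
rewrite -norm_cvg0P fine_cvgP; split=> [[_]//|h]; split => //.
by apply: nearW.
Qed.

Lemma c00_sum {R : realType} (I : Type) (r : seq I) (P : pred I) (y : I -> nat -> R) :
  (forall i, c00 (y i)) -> c00 (\sum_(i <- r | P i) y i).
Proof.
move=> hy; elim/big_ind: _ => //; first by exists 0%N.
move=> u v [M hM] [N hN]; exists (maxn M N) => n; rewrite geq_max => /andP[Mn Nn].
by rewrite -[LHS]/(u n + v n) hM// hN// addr0.
Qed.

Lemma c00_scale {R : realType} (a : R) (y : nat -> R) : c00 y -> c00 (a *: y).
Proof.
move=> [N hN]; exists N => n /hN; rewrite -[(a *: y) n]/(a * y n) => ->.
exact: mulr0.
Qed.

(** Reduces the question to a genuine normed space. Since [A] consists of finitely supported
    sequences, the Cesaro means themselves witness that their limit lies in [XF]; conversely a limit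
    in [XF] has finite norm because its distance to some mean is finite. *)
Lemma BanachSaks_set_XFE {R : realType} (F : fin_family) (A : set (nat -> R)) :
  A `<=` c00 ->
  BanachSaks_set_XF F A <-> BanachSaks_set ((@nfval R F) @^-1` A).
Proof.
move=> Ac; split=> hA y yA.
  have [phi [phii [x xXF hx]]] := hA (fun n => nfval (y n)) yA.
  pose c := cesaro (y \o phi).
  have cE k : cesaro ((fun n => nfval (y n)) \o phi) k = nfval (c k).
    by rewrite nfval_cesaro.
  have hc : (fun k => normF F (nfval (c k) - x)) @ \oo --> 0%E.
    by under eq_fun do rewrite -cE.
  have xF : x \in finite_normF F.
    have [/(@filter_ex _ _ _)[k hk] _] := (fine_cvgP _ _).1 hc.
    have dF : nfval (c k) - x \in finite_normF F.
      by apply/asboolP; exists (fine (normF F (nfval (c k) - x))); rewrite fineK.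
    move: (c k) dF => [u uF] /= dF; rewrite -(subKr u x).
    exact: rpredB uF dF.
  exists phi; split=> //; exists (NormFSpace xF).
  exact/subr_cvg0/normF_cvg0.
pose y' n := NormFSpace (c00_finite_normF F (Ac _ (yA n))).
have [phi [phii [l hl]]] := hA y' yA.
have cE k : cesaro (y \o phi) k = nfval (cesaro (y' \o phi) k).
  by rewrite nfval_cesaro.
have hl0 : (fun k => normF F (cesaro (y \o phi) k - nfval l)) @ \oo --> 0%E.
  under eq_fun do rewrite cE.
  by apply: (normF_cvg0 (fun k => cesaro (y' \o phi) k - l)).2; exact/subr_cvg0.
exists phi; split => //; exists (nfval l) => //.
exists (cesaro (y \o phi)); split => // k.
by apply: c00_scale; apply: c00_sum => i; exact: (Ac _ (yA _)).
Qed.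

Definition nfunit (R : realType) (F : fin_family) (n : nat) : normF_space R F.
Proof.
refine (@NormFSpace R F (unit_vec n) (c00_finite_normF F _)).
by exists n.+1 => k nk; rewrite /unit_vec gtn_eqF.
Defined.

Lemma range_unit_vec_preimage (R : realType) (F : fin_family) :
  (@nfval R F) @^-1` (range (@unit_vec R)) = range (nfunit R F).
Proof.
apply/seteqP; split => [x [n _ nx]|_ [n _ <-]]; last by exists n.
by exists n => //; apply: val_inj.
Qed.

Lemma conv_unit_vec_c00 (R : realType) : conv_hull (range (@unit_vec R)) `<=` c00.
Proof.
move=> z [m [c [p [_ [_ [hp ->]]]]]]; apply: c00_sum => i; apply: c00_scale.
have [n _ <-] := hp i.
by exists n.+1 => k nk; rewrite /unit_vec gtn_eqF.
Qed.

Lemma conv_unit_vec_preimage (R : realType) (F : fin_family) :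
  (@nfval R F) @^-1` (conv_hull (range (@unit_vec R))) = conv_hull (range (nfunit R F)).
Proof.
apply/seteqP; split=> z [m [c [p [c0 [c1 [hp hz]]]]]].
  have /choice[g hg] : forall i, exists n, unit_vec n = p i.
    by move=> i; have [n _ <-] := hp i; exists n.
  exists m, c, (nfunit R F \o g); split=> //; split=> //.
  split; first by move=> i; exists (g i).
  by apply: val_inj; rewrite /= hz nfval_sum; apply: eq_bigr => i _; rewrite -hg.
exists m, c, (fun i => nfval (p i)); split=> //; split => //; split.
  by move=> i; have [n _ <-] := hp i; exists n.
by rewrite hz nfval_sum.
Qed.

(** * Cesaro means *)

Lemma big_fset_uniq_seq {V : nmodType} (s : seq nat) (f : nat -> V) : uniq s ->
  \sum_(i <- [fset x in s]%fset) f i = \sum_(i <- s) f i.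
Proof.
move=> us; apply: perm_big; apply: uniq_perm; rewrite ?fset_uniq// => i.
by rewrite inE.
Qed.

Lemma strictly_incr_uniq (phi : nat -> nat) s : strictly_incr phi ->
  uniq s -> uniq (map phi s).
Proof. by move=> phii; rewrite map_inj_uniq//; exact: strictly_incr_inj. Qed.

(** The block sum is [2N+2] times one Cesaro mean minus [N+1] times another; were both means below
    [e / 4] in norm, it would stay below three quarters of [e (N+1)]. *)
Lemma cesaro_block_not_null {R : realType} {X : normedModType R} (y : nat -> X) (e : R) :
  0 < e -> (forall N, e * N.+1%:R <= `|\sum_(N.+1 <= k < (N.+1).*2) y k|) ->
  ~ (cesaro y @ \oo --> (0 : X)).
Proof.
move=> e0 hy /cvgrPdist_lt /(_ (e / 4%:R)).
rewrite divr_gt0// => /(_ isT)[M _ hM].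
have n1 n : `|\sum_(k < n.+1) y k| = n.+1%:R * `|cesaro y n|.
  by rewrite /cesaro normrZ gtr0_norm ?invr_gt0 ?ltr0n// mulrA divff ?mul1r// pnatr_eq0.
(* As [cesaro y n] averages [n.+1] terms, these two means cover the first [M+1] and the first [2M+2]
   terms. *)
have := hM M (leqnn M); have := hM (M.+1.*2).-1; rewrite /= => /(_ _).
have h2 : (M <= (M.+1.*2).-1)%N by rewrite -addnn addSn /= -addSnnS leq_addl.
move=> /(_ h2); rewrite !sub0r !normrN => c2 c1.
have := hy M; rewrite leNgt => /negP; apply.
have -> : \sum_(M.+1 <= k < (M.+1).*2) y k =
    \sum_(k < (M.+1.*2).-1.+1) y k - \sum_(k < M.+1) y k.
  rewrite prednK ?double_gt0// -!(big_mkord xpredT y).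
  have Mn : (M.+1 <= M.+1.*2)%N by rewrite -addnn leq_addr.
  by rewrite (big_cat_nat (leq0n _) Mn) /= addrAC subrr add0r.
apply: le_lt_trans (ler_normB _ _) _; rewrite !n1 prednK ?double_gt0//.
move: c1 c2; set a := `|cesaro y M|; set b := `|cesaro y _| => c1 c2.
have m0 : 0 < M.+1%:R :> R by rewrite ltr0n.
rewrite -muln2 natrM; move: (M.+1%:R : R) m0 => m m0.
rewrite -mulrA -mulrDr [ltRHS]mulrC ltr_pM2l//.
by lra.
Qed.

(* Along a subsequence whose Schreier sets lie in F, the mean over [N+1, 2N+2) has
   norm at least [e]; it is a combination of two Cesaro means. *)
Lemma BanachSaks_not_large {R : realType} {X : normedModType R} (x : nat -> X)
    (F : fin_family) (M : set nat) (e : R) :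
  hereditary F -> infinite_set M -> large F M -> 0 < e ->
  (forall s, F s -> e * #|` s|%:R <= `|\sum_(n <- s) x n|) ->
  (forall psi l, strictly_incr psi -> cesaro (x \o psi) @ \oo --> l -> l = 0) ->
  ~ BanachSaks_set (range x).
Proof.
move=> hF Minf lF e0 hx x0 BS.
have [phi [phii hphi]] := incr_of_infinite Minf.
have lF' : large F (range phi).
  by move=> n K Kphi; apply: lF => k /Kphi[i _ <-]; exact: hphi.
have [psi [psii hpsi]] := large_schreier hF phii lF'.
have [|theta [thetai [l hl]]] := BS (x \o (phi \o psi)).
  by move=> n; exists (phi (psi n)).
have ci : strictly_incr (phi \o psi) by exact: strictly_incr_comp.
have l0 : l = 0.
  by apply: (x0 ((phi \o psi) \o theta)) hl; exact: strictly_incr_comp.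
move: hl; rewrite l0; apply: cesaro_block_not_null e0 _ => N.
(* These [N+1] positions are at least [N+1] and [theta] does not lower them, so their images form a
   Schreier set. *)
pose v := index_iota N.+1 N.+1.*2.
have sv : size v = N.+1 by rewrite size_iota -addnn addnK.
have uv : uniq (map (phi \o psi) (map theta v)).
  by do 2![apply: strictly_incr_uniq => //]; exact: iota_uniq.
have Fv : F [fset z in map (phi \o psi) (map theta v)]%fset.
  apply: hpsi; last first.
    rewrite size_map sv => i /mapP[j jv ->]; move: jv; rewrite mem_index_iota.
    by move=> /andP[Nj _]; apply: leq_trans Nj _; exact: strictly_incr_ge.
  by apply: homo_sorted (iota_ltn_sorted _ _) => i j /= ij; rewrite strictly_incr_lt.
have := hx _ Fv; rewrite card_fseq undup_id// !size_map sv big_fset_uniq_seq//.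
by rewrite !big_map.
Qed.

Lemma sum_disjoint_le1 {R : realType} (f : nat -> R) N :
  (forall k, `|f k| <= 1) -> (forall j k, f j != 0 -> f k != 0 -> j = k) ->
  `|\sum_(k < N) f k| <= 1.
Proof.
move=> f1 fd; have [[i fi]|h] := pselect (exists i : 'I_N, f i != 0).
  rewrite (bigD1 i)//= big1 ?addr0// => j ji; apply: contraNeq ji => fj.
  by apply/eqP/val_inj; exact: fd.
rewrite big1 ?normr0// => i _; apply: contra_notP h => /eqP fi.
by exists i.
Qed.

(** At most one term contributes to a given coordinate, so this coordinate of the [N]-th mean is at
    most [1/(N+1)]. *)
Lemma cesaro_disjoint_lim {R : realType} (F : fin_family) (z : nat -> normF_space R F) l :
  (forall k n, `|nfval (z k) n| <= 1) ->
  (forall n j k, nfval (z j) n != 0 -> nfval (z k) n != 0 -> j = k) ->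
  cesaro z @ \oo --> l -> l = 0.
Proof.
move=> z1 zd zl; apply: val_inj; apply/funext => n /=.
apply/eqP; rewrite -normr_le0; apply/ler_addgt0Pr => e e0; rewrite add0r.
have e20 : 0 < e / 2 by rewrite divr_gt0.
move/cvgrPdist_lt : zl => /(_ _ e20) zl.
have /cvgrPdist_lt/(_ _ e20) hh := @cvg_harmonic R.
near \oo => N.
have h1 : `|l - cesaro z N| < e / 2 by near: N.
have h2 : `|0 - harmonic N| < e / 2 :> R by near: N.
have h3 : `|nfval (cesaro z N) n| <= harmonic N.
  rewrite nfval_cesaro /cesaro -[(_ *: _) n]/(_ * _) normrM gtr0_norm ?invr_gt0 ?ltr0n//.
  rewrite ler_piMr ?invr_ge0// fct_sumE.
  by apply: (@sum_disjoint_le1 _ (fun k => nfval (z k) n)); [move=> k; exact: z1|exact: zd].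
have h4 := nfnorm_coord (l - cesaro z N) n; rewrite -nfnormE in h4.
move: h2; rewrite sub0r normrN gtr0_norm ?invr_gt0 ?ltr0n// => h2.
have -> : nfval l n = nfval (l - cesaro z N) n + nfval (cesaro z N) n.
  by rewrite -[nfval (l - _) n]/(nfval l n - nfval (cesaro z N) n) subrK.
apply: le_trans (ler_normD _ _) _.
by rewrite [e]splitr lerD// ltW//; [exact: le_lt_trans h4 h1|exact: le_lt_trans h3 h2].
Unshelve. all: by end_near. Qed.

(** If [f (x n)] does not tend to 0, it stays beyond [e] with a fixed sign along a subsequence.
    Averages keep this bound, whereas some Cesaro means of that subsequence tend to 0. *)
Lemma weakly_null_of_BanachSaks {R : realType} {X : normedModType R} (x : nat -> X) :
  BanachSaks_set (range x) ->
  (forall psi l, strictly_incr psi -> cesaro (x \o psi) @ \oo --> l -> l = 0) ->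
  weakly_null x.
Proof.
move=> BS x0 f fc; apply: contrapT => nf.
have [e e0 he] : exists2 e : R, 0 < e & forall N, exists2 n, (N <= n)%N & e <= `|f (x n)|.
  apply: contrapT => h; apply: nf; apply/cvgrPdist_lt => e e0.
  apply: contrapT => h'; apply: h; exists e => // N; apply: contrapT => h''.
  apply: h'; exists N => // n /= Nn; rewrite sub0r normrN ltNge; apply/negP => en.
  by apply: h''; exists n.
have [phi [phii hphi]] := incr_of_unbounded (K := fun n => e <= `|f (x n)|) he.
have [psi [psii hpsi]] := prop_subseq (fun n => 0 <= f (x (phi n)) :> R).
have [c c1 hc] : exists2 c : R, `|c| = 1 & forall n, e <= c * f (x (phi (psi n))).
  case: hpsi => h; [exists 1|exists (-1)]; rewrite ?normrN ?normr1// => n.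
    by rewrite mul1r -(ger0_norm (h n)); exact: hphi.
  rewrite mulN1r -ltr0_norm ?hphi// ltNge; apply/negP; exact: h.
have [|theta [thetai [l hl]]] := BS (x \o (phi \o psi)).
  by move=> n; exists (phi (psi n)).
have l0 : l = 0.
  apply: (x0 ((phi \o psi) \o theta)) hl.
  by apply: strictly_incr_comp => //; exact: strictly_incr_comp.
have fl : f (cesaro (x \o (phi \o psi) \o theta) n) @[n --> \oo] --> (0 : R).
  have -> : (0 : R) = f l by rewrite l0 linear0.
  by apply: continuous_cvg => //; exact: fc.
move/cvgrPdist_lt : fl => /(_ _ e0)[N _ /(_ N (leqnn N))].
rewrite sub0r normrN; apply/negP; rewrite -leNgt.
rewrite -[leRHS]mul1r -c1 -normrM; apply: le_trans (ler_norm _).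
rewrite /cesaro linearZ linear_sum /= -[_ *: _]/(_ * _) mulrCA mulr_sumr.
rewrite ler_pdivlMl ?ltr0n// mulr_natl -[N.+1 in leLHS]card_ord -sumr_const.
by apply: ler_sum => i _; exact: hc.
Qed.

(** * The unit basis *)

Lemma nfunitE (R : realType) (F : fin_family) k n :
  nfval (nfunit R F k) n = (n == k)%:R.
Proof. by []. Qed.

Lemma nfunit_neq0 (R : realType) (F : fin_family) k n :
  (nfval (nfunit R F k) n != 0) = (n == k).
Proof. by rewrite nfunitE pnatr_eq0 eqb0 negbK. Qed.

Lemma nfunit_le1 (R : realType) (F : fin_family) k n : `|nfval (nfunit R F k) n| <= 1.
Proof. by rewrite nfunitE; case: eqP; rewrite ?normr1 ?normr0. Qed.

Lemma norm_nfunit (R : realType) (F : fin_family) k : `|nfunit R F k| = 1.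
Proof.
apply/eqP; rewrite nfnormE eq_le; apply/andP; split.
  apply/nfnorm_le; split=> [n|s _]; first exact: nfunit_le1.
  have := @ler_sum_uniq R nat s [:: k] (fun n => `|nfval (nfunit R F k) n|).
  rewrite big_seq1 => h; apply: (@le_trans _ _ `|nfval (nfunit R F k) k|).
    by apply: h => [//||i _]; [exact: fset_uniq|rewrite normr_eq0 nfunit_neq0 inE].
  exact: nfunit_le1.
by have := nfnorm_coord (nfunit R F k) k; rewrite nfunitE eqxx normr1.
Qed.

Lemma cesaro_nfunit_lim (R : realType) (F : fin_family) psi l : strictly_incr psi ->
  cesaro (nfunit R F \o psi) @ \oo --> l -> l = 0.
Proof.
move=> psii; apply: cesaro_disjoint_lim => [k n|n j k]; first exact: nfunit_le1.
rewrite /comp !nfunit_neq0 => /eqP -> /eqP; exact: strictly_incr_inj.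
Qed.

Lemma cesaro_cst {R : realType} {X : normedModType R} (x : X) n :
  cesaro (fun=> x) n = x.
Proof.
by rewrite /cesaro sumr_const card_ord -[x *+ _]scaler_nat scalerA mulVf ?scale1r// pnatr_eq0.
Qed.

Lemma harmonic_small {R : realType} (C e : R) : 0 < e ->
  \forall N \near \oo, C * N.+1%:R^-1 <= e.
Proof.
move=> e0; have : C * harmonic N @[N --> \oo] --> C * 0 by apply: cvgMr; exact: cvg_harmonic.
rewrite mulr0 => /cvgrPdist_le/(_ _ e0); apply: filterS => N.
by rewrite sub0r normrN; apply: le_trans; exact: ler_norm.
Qed.

Lemma count_meets (s : {fset nat}) (K : set nat) (kappa : nat -> nat) n N :
  strictly_incr kappa -> (forall i, K (kappa i)) -> ~ meets_at_least s K n ->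
  (\sum_(k < N) (kappa k \in s) <= n)%N.
Proof.
move=> ki Kk /negP; rewrite -ltnNge => /ltnW; apply: leq_trans.
rewrite -(big_mkord xpredT (fun k => nat_of_bool (kappa k \in s))) -big_mkcond /=.
rewrite sum1_count -size_filter -(size_map kappa).
apply: uniq_leq_size.
  by apply: strictly_incr_uniq => //; rewrite filter_uniq// iota_uniq.
move=> x /mapP[k]; rewrite mem_filter => /andP[ks _ ->].
by rewrite !inE ks; apply/asboolP.
Qed.

(** A sequence of unit vectors has a subsequence with constant or strictly increasing indices. In
    the second case non-largeness yields [n] and an infinite [K] that every [s] in [F] meets in
    fewer than [n] points, and along [K] the means are of order [n/(N+1)]. *)
Lemma nfunit_BanachSaks (R : realType) (F : fin_family) :
  (forall M : set nat, infinite_set M -> ~ large F M) ->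
  BanachSaks_set (range (nfunit R F)).
Proof.
move=> nlF y yu; have /choice[m hm] : forall n, exists k, y n = nfunit R F k.
  by move=> n; have [k _ <-] := yu n; exists k.
have [phi [phii [mphi|[v hv]]]] := nat_subseq m; last first.
  exists phi; split => //; exists (nfunit R F v).
  have -> : y \o phi = fun=> nfunit R F v by apply/funext => n /=; rewrite hm hv.
  rewrite (_ : cesaro _ = fun=> nfunit R F v); first exact: cvg_cst.
  by apply/funext => n; exact: cesaro_cst.
have /existsNP[n /existsNP[K /not_implyP[Kphi /not_implyP[Kinf hK]]]] :=
  nlF _ (infinite_range_incr mphi).
have [kappa [ki hk]] := incr_of_infinite Kinf.
have /choice[theta htheta] : forall i, exists j, m (phi j) = kappa i.
  by move=> i; have [j _ <-] := Kphi _ (hk i); exists j.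
have thetai : strictly_incr theta.
  by move=> i; rewrite -(strictly_incr_lt mphi) /= !htheta; exact: ki.
exists (phi \o theta); split; first exact: strictly_incr_comp.
exists 0; have -> : y \o (phi \o theta) = nfunit R F \o kappa.
  by apply/funext => i /=; rewrite hm htheta.
(* [n.+1] rather than [n], so that the bound also covers the supremum part of the norm when
   [n = 0]. *)
apply/cvgrPdist_le => e e0; have := @harmonic_small R n.+1%:R e e0.
apply: filterS => N; apply: le_trans; rewrite sub0r normrN.
have N0 : 0 < N.+1%:R :> R by rewrite ltr0n.
have cE p : nfval (cesaro (nfunit R F \o kappa) N) p =
    N.+1%:R^-1 * \sum_(k < N.+1) (p == kappa k)%:R.
  by rewrite nfval_cesaro /cesaro -[(_ *: _) p]/(_ * _) fct_sumE.
rewrite nfnormE; apply/nfnorm_le; split=> [p|s Fs].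
  rewrite cE normrM gtr0_norm ?invr_gt0// mulrC ler_pM2r ?invr_gt0//.
  apply: (@le_trans _ _ 1); last by rewrite ler1n.
  apply: (@sum_disjoint_le1 _ (fun k => (p == kappa k)%:R)) => [k|j k].
    by case: eqP; rewrite ?normr1 ?normr0.
  by rewrite !pnatr_eq0 !eqb0 !negbK => /eqP -> /eqP /(strictly_incr_inj ki).
under eq_bigr do rewrite cE ger0_norm ?mulr_ge0 ?invr_ge0 ?sumr_ge0//.
rewrite -mulr_sumr mulrC ler_pM2r ?invr_gt0// exchange_big /=.
apply: (@le_trans _ _ n%:R); last by rewrite ler_nat.
apply: (@le_trans _ _ (\sum_(k < N.+1) (kappa k \in s))%:R); last first.
  rewrite ler_nat; apply: count_meets ki hk _ => sK.
  by apply: hK; exists s.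
rewrite natr_sum ler_sum// => k _; rewrite -natr_sum ler_nat.
have [ks|ks] := boolP (kappa k \in s).
  by rewrite (bigD1_seq (kappa k)) ?fset_uniq//= eqxx big1 // => i /negPf ->.
by rewrite big_seq big1// => i si; case: eqP => // ik; move: ks; rewrite -ik si.
Qed.

Lemma meas_sum {R : realType} (I : nat -> {fset nat}) (mu : nat -> nat -> R) n
    (s : {fset nat}) :
  prob_on (I n) (mu n) -> \sum_(i <- s) mu n i = meas I mu n s.
Proof.
move=> [_ [mu0 _]]; rewrite /meas; symmetry; apply: big_fset_incl.
  exact: fsubsetIl.
by move=> i si; rewrite inE si /= => /mu0.
Qed.

Lemma hereditary_G_family {R : realType} F I (mu : nat -> nat -> R) delta :
  hereditary (G_family F I mu delta).
Proof.
move=> s t /fsubsetP st [u Fu hu]; exists u => // n /st; exact: hu.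
Qed.

(** The vector [y k] has coordinates [mu k]. If [s] in [F] witnesses that [t] is in the family [G],
    summing the coordinates of the [y k], [k] in [t], over [s] gives at least [delta] for each [k];
    hence the block argument applies to [G]. *)
Lemma conv_nfunit_not_BanachSaks {R : realType} (F : fin_family)
    (I : nat -> {fset nat}) (mu : nat -> nat -> R) delta :
  partition_fin I -> (forall n, prob_on (I n) (mu n)) -> 0 < delta ->
  large (G_family F I mu delta) setT ->
  ~ BanachSaks_set (conv_hull (range (nfunit R F))).
Proof.
move=> [_ Id] hmu d0 lG BS.
pose y k : normF_space R F := \sum_(i <- I k) mu k i *: nfunit R F i.
have yE k n : nfval (y k) n = mu k n.
  rewrite /y nfval_sum_coord.
  under eq_bigr do rewrite -[nfval (_ *: _) n]/(_ * (n == _)%:R).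
  have [nI|nI] := boolP (n \in I k).
    rewrite (bigD1_seq n) ?fset_uniq//= eqxx mulr1 big1 ?addr0// => i /negPf ni.
    by rewrite eq_sym ni mulr0.
  rewrite (hmu k).2.1// big_seq big1// => i iI; case: eqP => [ni|_]; last by rewrite mulr0.
  by move: nI; rewrite ni iI.
have yconv k : conv_hull (range (nfunit R F)) (y k).
  exists (size (I k)), (fun i => mu k (nth 0%N (I k) i)),
    (fun i => nfunit R F (nth 0%N (I k) i)); split; first by move=> i; exact: (hmu k).1.
  split; first by rewrite -(hmu k).2.2 (big_nth 0%N) big_mkord.
  by split; [move=> i; exists (nth 0%N (I k) i)|rewrite /y (big_nth 0%N) big_mkord].
have hG := @hereditary_G_family R F I mu delta.
apply: (BanachSaks_not_large (x := y) hG infinite_nat lG d0).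
- move=> t [s Fs hs]; apply: le_trans (nfnorm_sum _ Fs).
  apply: (@le_trans _ _ (\sum_(n <- s) \sum_(k <- t) mu k n)); last first.
    apply: ler_sum => n _; rewrite nfval_sum_coord.
    by rewrite (eq_bigr (fun k => nfval (y k) n)) ?ler_norm// => k _; rewrite yE.
  rewrite exchange_big /= mulr_natr -[X in X <= _]addr0 -iter_addr -count_predT -big_const_seq.
  rewrite [leLHS]big_seq [leRHS]big_seq; apply: ler_sum => k kt.
  by rewrite (meas_sum _ (hmu k)) hs.
- move=> psi l psii; apply: cesaro_disjoint_lim => [k n|n j k].
    rewrite /= yE ger0_norm ?(hmu _).1//.
    have [nI|nI] := boolP (n \in I (psi k)); last by rewrite (hmu _).2.1.
    rewrite -(hmu (psi k)).2.2 (bigD1_seq n) ?fset_uniq//= lerDl sumr_ge0// => i _.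
    exact: (hmu _).1.
  have nI i : mu i n != 0 -> n \in I i by apply: contraR => /(hmu i).2.1 ->.
  rewrite /= !yE => /nI nj /nI nk; apply: (strictly_incr_inj psii); exact: Id nj nk.
- by move=> z zy; apply: BS => n; have [k _ <-] := zy n.
Qed.

(** * Sequences in the convex hull *)

(** Coefficients of points with the same chosen index are added together. *)
Lemma conv_hull_range {R : realType} {X : lmodType R} (x : nat -> X) z :
  conv_hull (range x) z -> exists (a : nat -> R) (B : nat),
    [/\ forall n, 0 <= a n, forall n, (B <= n)%N -> a n = 0,
        \sum_(n < B) a n = 1 & z = \sum_(n < B) a n *: x n].
Proof.
move=> [m [c [p [c0 [c1 [hp ->]]]]]].
have /choice[g hg] : forall i, exists n, x n = p i.
  by move=> i; have [n _ <-] := hp i; exists n.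
pose B := \max_(i < m) g i.
have gB i : (g i < B.+1)%N by rewrite ltnS; exact: leq_bigmax.
have gE i (n : 'I_B.+1) : (inord (g i) == n) = (g i == n).
  by rewrite -val_eqE /= inordK.
exists (fun n => \sum_(i < m | g i == n) c i), B.+1; split.
- by move=> n; exact: sumr_ge0.
- move=> n Bn; apply: big1 => i /eqP gi; have := gB i.
  by rewrite gi ltnNge Bn.
- rewrite -c1 (partition_big (fun i => inord (g i) : 'I_B.+1) xpredT)//=.
  by apply: eq_bigr => n _; apply: eq_bigl => i; rewrite gE.
- rewrite (partition_big (fun i => inord (g i) : 'I_B.+1) xpredT)//=.
  apply: eq_bigr => n _; rewrite scaler_suml; apply: eq_big => i; first by rewrite gE.
  by rewrite gE => /eqP <-; rewrite hg.
Qed.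

Lemma strictly_incr_cvg (phi : nat -> nat) : strictly_incr phi -> phi @ \oo --> \oo.
Proof.
move=> phii A [N _ hN]; exists N => // n /= Nn; apply: hN => /=.
exact: leq_trans Nn (strictly_incr_ge _ phii).
Qed.

(** Bolzano-Weierstrass in one coordinate at each stage, then the diagonal. *)
Lemma pointwise_cvg_subseq {R : realType} (a : nat -> nat -> R) :
  (forall k n, `|a k n| <= 1) ->
  exists phi, strictly_incr phi /\ forall n, cvg ((fun k => a (phi k) n) @ \oo).
Proof.
move=> a1; pose Q (n : nat) (chi chi' : nat -> nat) := cvg ((fun k => a (chi' k) n) @ \oo).
have [|n chi chii|chi [rho [_ chii rhoi chiQ chiE]]] := @fusion Q id; first exact: ltnSn.
  have [|f /increasing_seqP fi fc] := @bolzano_weierstrass R (fun k => a (chi k.+1) n).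
    by exists 1; split => // M M1 k _ /=; exact: le_trans (a1 _ _) (ltW M1).
  by exists f; split => // k; have := fi k; rewrite ltEnat.
exists (fun n => chi n 0%N); split; first exact: fusion_incr chiE.
move=> n; have /cvg_ex[/= l hl] := chiQ n; apply/cvg_ex; exists l.
rewrite -(cvg_shiftn n.+1).
under eq_fun do rewrite addnC chiE.
apply: (@cvg_comp _ _ _ (rho n.+1) (fun k => a (chi n.+1 k) n)); last exact: hl.
exact: strictly_incr_cvg.
Qed.

(** Each [L j.+1] is placed past the support of row [kappa j], and the next row is chosen so late
    that it is close to [c] below [L j.+1]. *)
Lemma gliding_hump {R : realType} (a : nat -> nat -> R) (B : nat -> nat) (c : nat -> R) :
  (forall k n, (B k <= n)%N -> a k n = 0) ->
  (forall n, a k n @[k --> \oo] --> c n) ->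
  exists kappa L : nat -> nat, [/\ strictly_incr kappa, strictly_incr L,
    forall j n, (L j.+1 <= n)%N -> a (kappa j) n = 0 &
    forall j, \sum_(n < L j) `|a (kappa j) n - c n| <= harmonic j].
Proof.
move=> aB ac.
have small N e : 0 < e -> \forall k \near \oo, \sum_(n < N) `|a k n - c n| <= e.
  move=> e0; have : \sum_(n < N) `|a k n - c n| @[k --> \oo] --> \sum_(n < N) (0 : R).
    apply: cvg_big => [|n _]; first exact: add_continuous.
    by apply/norm_cvg0P/subr_cvg0; exact: ac.
  rewrite big1// => /cvgrPdist_le/(_ _ e0); apply: filterS => k.
  by rewrite sub0r normrN; apply: le_trans; exact: ler_norm.
have /choice[g hg] : forall p : nat * nat * nat, exists k, (p.2 < k)%N /\
    \sum_(n < p.1.2) `|a k n - c n| <= harmonic p.1.1.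
  move=> [[j N] k].
  have [|M _ hM] := small N (harmonic j); first by rewrite invr_gt0 ltr0n.
  exists (maxn M k.+1); split; first by rewrite /= leq_max leqnn orbT.
  by apply: hM; rewrite /= leq_maxl.
(* The pair holds [L j] and [kappa j]; as [L] starts at 0, the first estimate concerns an empty
   sum. *)
pose st := fix st j : nat * nat := if j is j'.+1 then
  let N := maxn (st j').1.+1 (B (st j').2) in (N, g (j, N, (st j').2)) else (0%N, 0%N).
exists (fun j => (st j).2), (fun j => (st j).1); split.
- by move=> j; exact: (hg (_, _, _)).1.
- by move=> j; rewrite /= leq_maxl.
- by move=> j n /= Ln; apply: aB; rewrite (leq_trans _ Ln)// leq_maxr.
- move=> [|j]; last exact: (hg (_, _, _)).2.
  by rewrite big_ord0 invr_ge0.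
Qed.

Lemma cesaro_cvg {R : realType} {X : normedModType R} (h : nat -> X) (y : X) :
  h @ \oo --> y -> cesaro h @ \oo --> y.
Proof.
move=> hy; have : (fun k => `|h k - y|) @ \oo --> (0 : R).
  by apply/norm_cvg0P/subr_cvg0.
move=> /sequences.cesaro hc; apply/subr_cvg0/norm_cvg0P.
apply: (squeeze_cvgr _ (cvg_cst 0) hc); apply: nearW => n; rewrite normr_ge0 /=.
have -> : cesaro h n - y = cesaro (fun k => h k - y) n.
  by rewrite -[in LHS](cesaro_cst y n) /cesaro -scalerBr -sumrB.
rewrite /cesaro normrZ gtr0_norm ?invr_gt0 ?ltr0n//.
rewrite /arithmetic_mean /= ler_pM2l ?invr_gt0 ?ltr0n// /series /= big_mkord.
exact: ler_norm_sum.
Qed.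

Lemma cesaroD {R : realType} {X : normedModType R} (u v : nat -> X) n :
  cesaro (fun k => u k + v k) n = cesaro u n + cesaro v n.
Proof. by rewrite /cesaro big_split scalerDr. Qed.

(* Along a subsequence the coefficients converge coordinatewise; the limit
   coefficients contribute the convergent part [h], and the remainders can be
   cut to disjoint intervals. *)
Lemma conv_seq_blocks {R : realType} {X : completeNormedModType R} (x : nat -> X)
    (y : nat -> X) :
  (forall n, `|x n| = 1) -> (forall k, conv_hull (range x) (y k)) ->
  exists (kappa L : nat -> nat) (w : nat -> nat -> R) (h : nat -> X) (l : X),
  [/\ strictly_incr kappa, strictly_incr L,
      forall j n, 0 <= w j n,
      (forall j, \sum_(L j <= n < L j.+1) w j n <= 1) &
      h @ \oo --> l /\
      forall j, y (kappa j) = h j + \sum_(L j <= n < L j.+1) w j n *: x n].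
Proof.
move=> x1 yconv.
have /choice[ab hab] : forall k, exists p : (nat -> R) * nat,
    [/\ forall n, 0 <= p.1 n, forall n, (p.2 <= n)%N -> p.1 n = 0,
        \sum_(n < p.2) p.1 n = 1 & y k = \sum_(n < p.2) p.1 n *: x n].
  by move=> k; have [a [B h]] := conv_hull_range (yconv k); exists (a, B).
pose a k := (ab k).1; pose B k := (ab k).2.
have a0 k n : 0 <= a k n.
  by have [h _ _ _] := hab k; exact: h.
have aB k n : (B k <= n)%N -> a k n = 0.
  by have [_ h _ _] := hab k; exact: h.
have wide (V : nmodType) (f : nat -> V) b b' : (b <= b')%N ->
    (forall n, (b <= n)%N -> f n = 0) -> \sum_(0 <= n < b') f n = \sum_(0 <= n < b) f n.
  move=> bb f0; rewrite (big_cat_nat (leq0n _) bb) /= [X in _ + X]big_nat_cond.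
  by rewrite [X in _ + X]big1 ?addr0// => n /andP[/andP[bn _] _]; exact: f0.
have a1 k N : \sum_(0 <= n < N) a k n <= 1.
  have [_ _ <- _] := hab k; rewrite -(big_mkord xpredT (a k)).
  have [NB|BN] := leqP N (B k); last by rewrite (wide _ _ _ _ (ltnW BN))//; exact: aB.
  by rewrite [leRHS](big_cat_nat (leq0n _) NB) /= lerDl sumr_ge0.
have an1 k n : `|a k n| <= 1.
  rewrite ger0_norm//; apply: le_trans (a1 k n.+1).
  by rewrite big_nat_recr //= lerDr sumr_ge0.
have [phi [phii hphi]] := pointwise_cvg_subseq an1.
pose c n : R := lim ((fun k => a (phi k) n) @ \oo).
have ac n : a (phi k) n @[k --> \oo] --> c n by exact: hphi.
have c0 n : 0 <= c n by apply: limr_ge; [exact: hphi|exact: nearW].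
have c1 N : \sum_(0 <= n < N) c n <= 1.
  have : \sum_(0 <= n < N) a (phi k) n @[k --> \oo] --> \sum_(0 <= n < N) c n.
    by apply: cvg_big => [|n _]; [exact: add_continuous|exact: ac].
  by move=> /cvgr_to_le; apply; apply: nearW => k.
have [kappa [L [ki Li aL hL]]] :=
  @gliding_hump R (fun k => a (phi k)) (B \o phi) c (fun k => aB (phi k)) ac.
(* The series converges absolutely: the [x n] are normalized and the partial sums of [c] are at most
   1. *)
have /cvg_ex[/= l hl] : cvgn (series (fun n => c n *: x n)).
  apply: normed_cvg; have -> : [normed series (fun n => c n *: x n)] = series c.
    by congr series; apply/funext => n /=; rewrite normrZ x1 mulr1 ger0_norm.
  apply: nondecreasing_is_cvgn; first exact: nondecreasing_series.
  by exists 1 => _ [N _ <-]; exact: c1.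
(* The head below [L j] differs from the partial sum of the limit series by at most [harmonic j]. *)
pose h j := \sum_(0 <= n < L j) a (phi (kappa j)) n *: x n.
exists (phi \o kappa), L, (fun j => a (phi (kappa j))), h, l; split => //.
- exact: strictly_incr_comp.
- move=> j; apply: le_trans (a1 (phi (kappa j)) (L j.+1)).
  by rewrite [leRHS](big_cat_nat (leq0n _) (ltnW (Li j))) /= lerDr sumr_ge0.
split => [|j].
  have hS : (fun j => series (fun n => c n *: x n) (L j)) @ \oo --> l.
    apply: (@cvg_comp _ _ _ L (series (fun n => c n *: x n))) hl.
    exact: strictly_incr_cvg.
  apply: cvg_sub0 hS; apply/norm_cvg0P.
  apply: (squeeze_cvgr _ (cvg_cst 0) (@cvg_harmonic R)); apply: nearW => j.
  rewrite normr_ge0 /=; apply: le_trans (hL j).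
  rewrite -[X in `|X|]/(h j - series (fun n => c n *: x n) (L j)) /h /series /=.
  rewrite -sumrB big_mkord; apply: le_trans (ler_norm_sum _ _ _) _.
  by apply: ler_sum => n _; rewrite -scalerBl normrZ x1 mulr1.
have [_ _ _ ->] := hab (phi (kappa j)).
rewrite -(big_mkord xpredT (fun n => a (phi (kappa j)) n *: x n)) /=.
rewrite /h -(big_cat_nat (leq0n _) (ltnW (Li j))) /=.
pose f n : X := a (phi (kappa j)) n *: x n.
have [BL|LB] := leqP (B (phi (kappa j))) (L j.+1).
  by rewrite (wide X f _ _ BL)// => n /aB; rewrite /f => ->; rewrite scale0r.
by rewrite (wide X f _ _ (ltnW LB))// => n /aL; rewrite /f => ->; rewrite scale0r.
Qed.

(** * Families defined by functionals *)

(** The bound on [f], read at [v] and at [- v], says that [f] is in the dual unit ball; continuity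
    follows from it. *)
Definition lower_family {R : realType} {X : normedModType R} (x : nat -> X) (e : R) :
    fin_family :=
  [set s | exists f : {linear X -> R^o}, (forall v, f v <= `|v|) /\
     forall n, n \in s -> e <= f (x n)].

Lemma hereditary_lower_family {R : realType} {X : normedModType R} (x : nat -> X) (e : R) :
  hereditary (lower_family x e).
Proof.
by move=> s t /fsubsetP st [f [f1 ft]]; exists f; split => // n /st; exact: ft.
Qed.

(* Diagonalising over the thresholds [harmonic n] bounds, for each n, the number of
   terms at which the functional norming a Cesaro mean exceeds [harmonic n]. *)
Lemma cesaro_null_subseq {R : realType} {X : normedModType R} (z : nat -> X) :
  (forall k, `|z k| <= 1) ->
  (forall phi e, strictly_incr phi -> 0 < e -> exists psi N, strictly_incr psi /\
     forall s, lower_family (z \o phi \o psi) e s -> (#|` s| < N)%N) ->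
  exists phi, strictly_incr phi /\ cesaro (z \o phi) @ \oo --> (0 : X).
Proof.
move=> z1 hz; pose Q (n : nat) (chi chi' : nat -> nat) := exists N, forall s,
  lower_family (z \o chi') (harmonic n) s -> (#|` s| < N)%N.
have [|n chi chii|chi [rho [_ chii rhoi chiQ chiE]]] := @fusion Q id; first exact: ltnSn.
  have [||psi [N [psii hN]]] := hz (chi \o S) (harmonic n).
  - exact: strictly_incr_comp.
  - by rewrite invr_gt0 ltr0n.
  - by exists psi; split => //; exists N.
pose delta n := chi n 0%N; have di : strictly_incr delta by exact: fusion_incr chiE.
exists delta; split => //; apply/cvgrPdist_le => e e0.
have e20 : 0 < e / 2 by rewrite divr_gt0.
have [n hn] : exists n, 1 * n.+1%:R^-1 <= e / 2.
  by have [n _ hn] := @harmonic_small R 1 _ e20; exists n; exact: hn (leqnn n).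
rewrite mul1r in hn; have [N hN] := chiQ n.
have := @harmonic_small R (n.+1 + N)%:R _ e20.
apply: filterS => M hM; rewrite sub0r normrN.
have [f [f1 fv]] := norming_functional (cesaro (z \o delta) M).
rewrite -fv /cesaro linearZ linear_sum /= -[_ *: _]/(_ * _).
have M0 : 0 < M.+1%:R :> R by rewrite ltr0n.
rewrite ler_pdivrMl//.
pose bad k := (n.+1 <= k)%N && (harmonic n <= f (z (delta k))).
(* Each term is at most 1 if it is among the first [n+1] or bad, and at most [harmonic n]
   otherwise. *)
have fle (k : 'I_M.+1) : f (z (delta k)) <= (k < n.+1)%N%:R + (bad k)%:R + harmonic n.
  have h0 : 0 <= harmonic n :> R by rewrite invr_ge0.
  have fz1 : f (z (delta k)) <= 1 by exact: le_trans (f1 _) (z1 _).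
  rewrite /bad; have [kn|nk] := ltnP k n.+1 => /=; first by rewrite addr0 ler_wpDr.
  rewrite add0r; have [hf|hf] := leP (harmonic n) (f (z (delta k))).
    by rewrite ler_wpDr.
  by rewrite add0r ltW.
apply: le_trans (ler_sum _ (fun k _ => fle k)) _.
rewrite !big_split /= -!natr_sum.
have small_n : (\sum_(k < M.+1) (k < n.+1) <= n.+1)%N.
  rewrite -(big_mkord xpredT (fun k => nat_of_bool (k < n.+1)%N)) -big_mkcond /=.
  rewrite sum1_count -size_filter -[leqRHS](size_iota 0); apply: uniq_leq_size.
    by rewrite filter_uniq// iota_uniq.
  by move=> k; rewrite mem_filter mem_iota => /andP[].
have small_bad : (\sum_(k < M.+1) bad k <= N)%N.
  rewrite -(big_mkord xpredT (fun k => nat_of_bool (bad k))) -big_mkcond /=.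
  rewrite sum1_count -size_filter; set l := [seq _ <- _ | _].
  have ln k : k \in l -> (n.+1 <= k)%N by rewrite mem_filter => /andP[/andP[]].
  (* [g k] is the position of [delta k] in the stage [chi n.+1], where [hN] bounds the number of bad
     indices. *)
  pose g k := rho n.+1 (k - n.+1)%N.
  have gi : {in l &, injective g}.
    move=> i j il jl /(strictly_incr_inj (rhoi n.+1)) ij.
    by rewrite -(subnK (ln i il)) ij subnK// ln.
  have ul : uniq (map g l) by rewrite map_inj_in_uniq// filter_uniq// iota_uniq.
  have := hN [fset k in map g l]%fset; rewrite card_fseq undup_id// size_map => h.
  apply: ltnW; apply: h; exists f; split => // i; rewrite inE => /mapP[k kl ->] /=.
  rewrite /g -chiE subnKC ?ln//.
  by move: kl; rewrite mem_filter => /andP[/andP[]].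
rewrite sumr_const card_ord -natrD.
apply: (@le_trans _ _ ((n.+1 + N)%:R + harmonic n *+ M.+1)).
  by rewrite lerD2r ler_nat leq_add.
rewrite [e]splitr mulrDr lerD//.
  by rewrite -ler_pdivrMl// mulrC.
by rewrite -[leLHS]mulr_natl ler_wpM2l// ltW.
Qed.

Lemma norm1_linear_continuous {R : realType} {X : normedModType R} (f : {linear X -> R^o}) :
  (forall v, f v <= `|v|) -> continuous f.
Proof.
move=> f1 v; apply/cvgrPdist_lt => e e0.
have /cvgrPdist_lt/(_ _ e0) : u @[u --> v] --> v by exact: cvg_id.
apply: filterS => u; apply: le_lt_trans.
rewrite -linearB ler_norml f1 andbT lerNl -linearN.
by rewrite (le_trans (f1 _))// normrN.
Qed.

(** The functional norming [l] sends the means both to the norm of [l] and, by the scalar Cesaro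
    theorem, to 0. *)
Lemma weakly_null_cesaro {R : realType} {X : normedModType R} (x : nat -> X) psi l :
  weakly_null x -> strictly_incr psi -> cesaro (x \o psi) @ \oo --> l -> l = 0.
Proof.
move=> x0 psii xl; have [f [f1 fl]] := norming_functional l.
have fc := norm1_linear_continuous f1.
have h1 : f (cesaro (x \o psi) n) @[n --> \oo] --> (f l : R^o).
  by apply: continuous_cvg => //; exact: fc.
have h2 : cesaro ((fun n => f (x n) : R^o) \o psi) @ \oo --> (0 : R^o).
  apply: cesaro_cvg; apply: (@cvg_comp _ _ _ psi (f \o x)); last exact: x0.
  exact: strictly_incr_cvg.
have h : (fun n => f (cesaro (x \o psi) n)) = cesaro ((fun n => f (x n) : R^o) \o psi).
  by apply/funext => n; rewrite /cesaro linearZ linear_sum.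
rewrite h in h1; have := cvg_unique _ h1 h2; rewrite fl => l0.
by apply/eqP; rewrite -normr_eq0 l0.
Qed.

(** The functional attached to [s] shows that the sum of the [x n] over [s] has norm at least [e]
    times the size of [s], as [BanachSaks_not_large] requires. *)
Lemma lower_family_not_large {R : realType} {X : normedModType R} (x : nat -> X) (e : R)
    (M : set nat) :
  weakly_null x -> BanachSaks_set (range x) -> 0 < e -> infinite_set M ->
  ~ large (lower_family x e) M.
Proof.
move=> x0 BS e0 Minf lM.
apply: (BanachSaks_not_large (@hereditary_lower_family R X x e) Minf lM e0 _ _ BS).
  move=> s [f [f1 fs]]; apply: le_trans (f1 _); rewrite linear_sum.
  rewrite mulr_natr -[X in X <= _]addr0 -iter_addr -count_predT -big_const_seq.
  by rewrite [leLHS]big_seq [leRHS]big_seq; apply: ler_sum => k kt; exact: fs.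
by move=> psi l; exact: weakly_null_cesaro.
Qed.

(** * Measures, partitions and compactness *)

(** The missing mass is placed at one point of [J]. *)
Lemma prob_completion {R : realType} (J : {fset nat}) (v : nat -> R) :
  J != fset0 -> (forall n, 0 <= v n) -> (forall n, n \notin J -> v n = 0) ->
  \sum_(n <- J) v n <= 1 -> exists mu, prob_on J mu /\ forall n, v n <= mu n.
Proof.
move=> /fset0Pn[a aJ] v0 vJ v1.
pose r := 1 - \sum_(n <- J) v n; have r0 : 0 <= r by rewrite subr_ge0.
exists (fun n => v n + r * (n == a)%:R); split; last by move=> n; rewrite lerDl mulr_ge0.
split; first by move=> n; rewrite addr_ge0// mulr_ge0.
split => [n nJ|].
  by rewrite vJ// add0r; case: eqP => [na|_]; [move: nJ; rewrite na aJ|rewrite mulr0].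
rewrite big_split /= [X in _ + X](bigD1_seq a) ?fset_uniq//= eqxx mulr1 [X in r + X]big1.
  by rewrite addr0 /r addrCA subrr addr0.
by move=> i /negPf ->; rewrite mulr0.
Qed.

Lemma interval_partition (L : nat -> nat) : strictly_incr L -> L 0%N = 0%N ->
  partition_fin (fun k => [fset n in index_iota (L k) (L k.+1)]%fset).
Proof.
move=> Li L0; split=> [m|n1 n2 m].
  have [|k|k Lk kmax] := @ex_maxnP (fun k => L k <= m)%N m.
  - by exists 0%N; rewrite L0.
  - exact: leq_trans (strictly_incr_ge _ Li).
  - exists k; rewrite inE mem_index_iota Lk ltnNge; apply/negP => /kmax.
    by rewrite ltnn.
rewrite !inE !mem_index_iota => /andP[a1 b1] /andP[a2 b2].
have := leq_ltn_trans a1 b2; have := leq_ltn_trans a2 b1.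
by rewrite !strictly_incr_lt// !ltnS => h1 h2; apply/eqP; rewrite eqn_leq h1 h2.
Qed.

Lemma large_finite_subsets (F : fin_family) (K : set nat) :
  (forall t : {fset nat}, (forall i, i \in t -> K i) -> F t) -> large F K.
Proof.
move=> hF n M MK Minf; have [kappa [ki hk]] := incr_of_infinite Minf.
exists [fset i in map kappa (iota 0 n)]%fset.
  by apply: hF => i; rewrite inE => /mapP[j _ ->]; exact/MK/hk.
rewrite /meets_at_least; set t := [fset i in _ | _]%fset.
have -> : t = [fset i in map kappa (iota 0 n)]%fset.
  apply/fsetP => i; rewrite !inE andb_idr// => /mapP[j _ ->]; exact/asboolP/hk.
rewrite card_fseq undup_id ?size_map ?size_iota//.
exact: strictly_incr_uniq ki (iota_uniq _ _).
Qed.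

Lemma ptws_bool_nbhs (g : {ptws nat -> bool}) N :
  nbhs g [set h | forall n, (n < N)%N -> h n = g n].
Proof.
elim: N => [|N IH]; first by apply: filterS filterT => h _ n.
have gN : nbhs g [set h | h N = g N].
  have h := @proj_continuous nat (fun=> bool) N g [set g N].
  by apply: h; rewrite nbhs_principalE.
apply: filterS (filterI IH gN) => h [hlt hN] n.
by rewrite ltnS leq_eqVlt => /predU1P[->//|/hlt].
Qed.

(** It suffices that [F] is closed in the Cantor space. If a limit point had infinite support,
    heredity would put all finite subsets of the support in [F], making [F] large there; a finite
    support is contained in a nearby member of [F]. *)
Lemma not_large_compact (F : fin_family) : hereditary F ->
  (forall M, infinite_set M -> ~ large F M) -> compact_family F.
Proof.
move=> hF nlF.
have cT : compact [set: {ptws nat -> bool}].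
  rewrite (_ : setT = [set f : {ptws nat -> bool} | forall n, [set: bool] (f n)]).
    by apply: (@tychonoff nat (fun=> bool) (fun=> setT)) => _; exact: bool_compact.
  by apply/seteqP; split.
apply: (subclosed_compact _ cT) => // g gF.
have agree N : exists2 s, F s & forall n, (n < N)%N -> (n \in s) = g n.
  by have [_ [[s Fs <-] sg]] := gF _ (ptws_bool_nbhs g N); exists s.
have gfin : finite_set [set n | g n].
  apply: contrapT => ginf; apply: (nlF _ ginf); apply: large_finite_subsets => t tg.
  have [s Fs hs] := agree (\max_(i <- t) i).+1; apply: hF Fs; apply/fsubsetP => i it.
  rewrite hs; first exact: tg.
  by rewrite ltnS (bigD1_seq i) ?fset_uniq//= leq_maxl.
have [s0 hs0] : exists s : {fset nat}, forall n, (n \in s) = g n.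
  exists (fset_set [set n | g n]) => n; rewrite in_fset_set//.
  by apply/idP/idP; rewrite inE.
exists s0; last by apply/funext => n; exact: hs0.
have [s Fs hs] := agree (\max_(i <- s0) i).+1; apply: hF Fs; apply/fsubsetP => i is0.
rewrite hs -?hs0//.
by rewrite ltnS (bigD1_seq i) ?fset_uniq//= leq_maxl.
Qed.

(** The selected weights live on intervals with gaps between them. The gaps are absorbed into larger
    intervals and the weights completed to probabilities, which only increases the masses to be
    bounded below. *)
Lemma lower_family_measures {R : realType} {X : normedModType R} (x : nat -> X)
    (L phi : nat -> nat) (w : nat -> nat -> R) (e : R) :
  (forall n, `|x n| = 1) -> strictly_incr L -> strictly_incr phi -> 0 < e ->
  (forall j n, 0 <= w j n) -> (forall j, \sum_(L j <= n < L j.+1) w j n <= 1) ->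
  let z j := \sum_(L j <= n < L j.+1) w j n *: x n in
  (forall psi N, strictly_incr psi ->
     exists2 s, lower_family (z \o phi \o psi) e s & (N <= #|` s|)%N) ->
  exists (I : nat -> {fset nat}) (mu : nat -> nat -> R) (delta : R),
    partition_fin I /\ (forall n, prob_on (I n) (mu n)) /\ 0 < delta /\
    large (G_family (lower_family x (e / 2)) I mu delta) setT.
Proof.
move=> x1 Li phii e0 w0 w1 z hz.
(* The value 0 at 0 lets the intervals cover all of [nat]. *)
pose L' k := if k is 0 then 0%N else L (phi k).
have L'L k : (L' k <= L (phi k))%N by case: k.
have LL' k : (L (phi k).+1 <= L' k.+1)%N.
  by have := phii k; rewrite leq_eqVlt => /predU1P[->//|h]; rewrite ltnW// strictly_incr_lt.
have L'i : strictly_incr L'.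
  by move=> k; apply: leq_ltn_trans (L'L k) _; apply: leq_trans (Li _) (LL' k).
pose I k := [fset n in index_iota (L' k) (L' k.+1)]%fset.
pose J k n := (L (phi k) <= n < L (phi k).+1)%N.
have JI k n : J k n -> n \in I k.
  rewrite inE mem_index_iota => /andP[h1 h2].
  by rewrite (leq_trans (L'L k) h1) (leq_trans h2 (LL' k)).
have /choice[mu hmu] : forall k, exists m, prob_on (I k) m /\
    forall n, (if J k n then w (phi k) n else 0) <= m n.
  move=> k; apply: prob_completion.
  - apply/fset0Pn; exists (L' k); rewrite inE mem_index_iota leqnn /=; exact: L'i.
  - by move=> n; case: ifP.
  - by move=> n nI; case: ifP => // /JI nI'; rewrite nI' in nI.
  - apply: le_trans (w1 (phi k)); rewrite -big_mkcond -big_filter.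
    apply: ler_sum_uniq => //; first by rewrite filter_uniq// fset_uniq.
    by move=> n; rewrite mem_filter mem_index_iota => /andP[].
have d0 : 0 < e / 2 by rewrite divr_gt0.
exists I, mu, (e / 2); split; first exact: interval_partition.
split; first by move=> n; exact: (hmu n).1.
split => // N K _ Kinf; have [kappa [ki hk]] := incr_of_infinite Kinf.
have [s [f [f1 fs]] sN] := hz kappa N ki.
pose t := [fset kappa i | i in s]%fset.
exists t; last first.
  rewrite /meets_at_least (_ : [fset i in t | _]%fset = t).
    by rewrite card_imfset//; exact: strictly_incr_inj.
  apply/fsetP => i; rewrite !inE andb_idr// => /imfsetP[j _ ->]; exact/asboolP/hk.
(* [b] is past the intervals of all [k] in [t], so the cut-off that makes [S] finite loses nothing
   on them. *)
pose b := \max_(k <- t) L' k.+1.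
pose S := [fset n in [seq n <- iota 0 b | e / 2 <= f (x n)]]%fset.
exists S.
  by exists f; split => // n; rewrite inE mem_filter => /andP[].
move=> _ /imfsetP[i /= si ->]; set k := kappa i.
have kt : k \in t by apply/imfsetP; exists i.
have bk : (L' k.+1 <= b)%N by rewrite /b (bigD1_seq k) ?fset_uniq//= leq_maxl.
have fx1 n : f (x n) <= 1 by rewrite -(x1 n).
have h1 : e <= \sum_(n <- index_iota (L (phi k)) (L (phi k).+1)) w (phi k) n * f (x n).
  apply: le_trans (fs i si) _; rewrite /= /z linear_sum le_eqVlt; apply/orP; left.
  by apply/eqP; apply: eq_bigr => n _; rewrite linearZ.
(* Indices with [f (x n) < e / 2] contribute at most [e / 2] altogether; at the others
   [f (x n) <= 1]. *)
have h2 : e <= \sum_(n <- index_iota (L (phi k)) (L (phi k).+1) | e / 2 <= f (x n))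
    w (phi k) n + e / 2.
  apply: le_trans h1 _.
  apply: (@le_trans _ _ (\sum_(n <- index_iota (L (phi k)) (L (phi k).+1))
     ((if e / 2 <= f (x n) then w (phi k) n else 0) + w (phi k) n * (e / 2)))).
    apply: ler_sum => n _; have := w0 (phi k) n; have := fx1 n.
    case: (leP (e / 2) (f (x n))) => [hf f1' wn|hf _ wn] /=; last first.
      by rewrite add0r ler_wpM2l// ltW.
    by rewrite ler_wpDr ?ler_piMr// mulr_ge0// ltW.
  rewrite big_split /= -big_mkcond lerD2l -mulr_suml ler_piMl ?w1//.
  exact: ltW.
apply: (@le_trans _ _ (\sum_(n <- index_iota (L (phi k)) (L (phi k).+1) | e / 2 <= f (x n))
    w (phi k) n)); first by move: h2; rewrite -lerBlDr; apply: le_trans; lra.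
rewrite -big_filter /meas.
apply: (@le_trans _ _ (\sum_(n <- [seq n <- index_iota (L (phi k)) (L (phi k).+1) |
    e / 2 <= f (x n)]) mu k n)).
  rewrite big_seq [leRHS]big_seq; apply: ler_sum => n; rewrite mem_filter mem_index_iota.
  by move=> /andP[_ Jn]; have := (hmu k).2 n; rewrite /J Jn.
apply: ler_sum_uniq => [n||n].
- exact: (hmu k).1.1.
- by rewrite filter_uniq// iota_uniq.
rewrite mem_filter mem_index_iota => /andP[fn Jn] _.
rewrite in_fsetI (JI k n Jn) andbT inE mem_filter fn mem_iota /= add0n.
have /andP[_ h] := Jn; apply: leq_trans (leq_trans (LL' k) bk); exact: h.
Qed.

Theorem theorem2p8 (R : realType) :
  let Pa := exists (X : completeNormedModType R) (x : nat -> X),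
      (forall n, `|x n| = 1) /\ weakly_null x /\
      BanachSaks_set (x @` [set: nat]) /\ ~ BanachSaks_set (conv_hull (x @` [set: nat])) in
  let Pb := exists F : fin_family,
      BanachSaks_set_XF F ((@unit_vec R) @` [set: nat]) /\
      ~ BanachSaks_set_XF F (conv_hull ((@unit_vec R) @` [set: nat])) in
  let Pc := exists F : fin_family,
      compact_family F /\ hereditary F /\
      (forall M : set nat, infinite_set M -> ~ large F M) /\
      exists (I : nat -> {fset nat}) (mu : nat -> nat -> R) (delta : R),
        partition_fin I /\ (forall n, prob_on (I n) (mu n)) /\ 0 < delta /\
        large (G_family F I mu delta) [set: nat] in
  (Pa <-> Pb) /\ (Pb <-> Pc).
Proof.
move=> Pa Pb Pc.
have unit_c00 : range (@unit_vec R) `<=` c00.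
  by move=> _ [n _ <-]; exists n.+1 => k nk; rewrite /unit_vec gtn_eqF.
have ba : Pb -> Pa.
  move=> [F []]; rewrite (BanachSaks_set_XFE F unit_c00) range_unit_vec_preimage => BS.
  rewrite (BanachSaks_set_XFE F (@conv_unit_vec_c00 R)) conv_unit_vec_preimage => nBS.
  exists (normF_space R F), (nfunit R F); split; first exact: norm_nfunit.
  split => //; apply: weakly_null_of_BanachSaks BS _ => psi l.
  exact: cesaro_nfunit_lim.
have cb : Pc -> Pb.
  move=> [F [_ [_ [nlF [I [mu [delta [pI [pmu [d0 lG]]]]]]]]]]; exists F.
  rewrite (BanachSaks_set_XFE F unit_c00) range_unit_vec_preimage.
  rewrite (BanachSaks_set_XFE F (@conv_unit_vec_c00 R)) conv_unit_vec_preimage.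
  split; first exact: nfunit_BanachSaks.
  exact: conv_nfunit_not_BanachSaks pI pmu d0 lG.
have ac : Pa -> Pc.
  move=> [X [x [x1 [x0 [BS /existsNP[y /not_implyP[yconv hy]]]]]]].
  have [kappa [L [w [h [l [ki Li w0 w1 [hl yE]]]]]]] := conv_seq_blocks x1 yconv.
  pose z j := \sum_(L j <= n < L j.+1) w j n *: x n.
  have z1 j : `|z j| <= 1.
    apply: le_trans (ler_norm_sum _ _ _) _; apply: le_trans (w1 j).
    by apply: ler_sum => n _; rewrite normrZ x1 mulr1 ger0_norm.
  (* Otherwise [cesaro_null_subseq] would make the means of [z] tend to 0 along a subsequence; those
     of [y] would then converge to [l], against [hy]. *)
  have [phi [e [phii e0 hz]]] : exists phi e, [/\ strictly_incr phi, 0 < e &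
      forall psi N, strictly_incr psi ->
        exists2 s, lower_family (z \o phi \o psi) e s & (N <= #|` s|)%N].
    apply: contrapT => nz; have [phi e phii e0|phi [phii zphi]] := cesaro_null_subseq z1.
      apply: contrapT => npsi; apply: nz; exists phi, e; split => // psi N psii.
      apply: contrapT => ns; apply: npsi; exists psi, N; split => // s ls.
      by rewrite ltnNge; apply/negP => Ns; apply: ns; exists s.
    apply: hy; exists (kappa \o phi); split; first exact: strictly_incr_comp.
    exists (l + 0).
    have -> : cesaro (y \o (kappa \o phi)) = cesaro (h \o phi) \+ cesaro (z \o phi).
      apply/funext => n /=; rewrite -cesaroD; congr (cesaro _ n).
      by apply/funext => k /=; rewrite yE.
    apply: cvgD zphi; apply: cesaro_cvg.
    exact: cvg_comp (strictly_incr_cvg phii) hl.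
  have e20 : 0 < e / 2 by rewrite divr_gt0.
  have nl M : infinite_set M -> ~ large (lower_family x (e / 2)) M.
    exact: lower_family_not_large x0 BS e20.
  have her := @hereditary_lower_family R X x (e / 2).
  exists (lower_family x (e / 2)); split; first exact: not_large_compact.
  do 2![split => //].
  exact: lower_family_measures x1 Li phii e0 w0 w1 hz.
split; first by split => [/ac/cb|/ba].
by split => [/ba/ac|/cb].
Qed.
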